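(* Let $\mathcal{L}_0$ be a separable Hilbert space, $A$ a contraction on $\mathcal{L}_0$, and $U_A$ the Sz.-Nagy–Foias unitary dilation of $A$, acting on $\mathbf{H}=\bigoplus_{n\in\mathbb{Z}}\mathcal{L}_n$ (each $\mathcal{L}_n$ a copy of $\mathcal{L}_0$). Let $\mathbf{S}$ be the bilateral shift of $\mathbf{H}$. Then $A$ is Schmidt decomposable if and only if $\mathbf{S}U_A$ is diagonalizable.
   Context: A contraction is a linear operator with $\|A\|\le1$. For a contraction $T$, $D_T=(1-T^*T)^{1/2}$. Operators on $\mathbf{H}$ are regarded as matrices $(T_{i,j})_{i,j\in\mathbb{Z}}$ of operators on $\mathcal{L}_0$, where $T_{i,j}$ maps the $j$-th summand to the $i$-th summand. The dilation $U_A=(U_{i,j})$ is the unitary operator with entries $$U_{0,0}=A,\quad U_{0,1}=D_{A^*},\quad U_{-1,0}=D_A,\quad U_{-1,1}=-A^*,\quad U_{i,i+1}=I_{\mathcal{L}_0}\ (i\ne0,-1),$$ and $U_{i,j}=0$ for all other $i,j\in\mathbb{Z}$. The bilateral shift $\mathbf{S}$ (of multiplicity $\dim\mathcal{L}_0$) carries the summand $\mathcal{L}_j$ identically onto $\mathcal{L}_{j+1}$, i.e. $(\mathbf{S}\xi)_{j+1}=\xi_j$ for $\xi=(\xi_j)_{j\in\mathbb{Z}}\in\mathbf{H}$ (all summands being identified with $\mathcal{L}_0$). An operator is diagonalizable if there is an orthonormal basis of the space consisting of its eigenvectors. A bounded operator $T$ is Schmidt decomposable if it has a singular value decomposition: there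 exist (finite or countable) orthonormal systems $\{f_n\}_{n\ge1}$, $\{g_n\}_{n\ge1}$ and positive numbers $s_n$ such that $T=\sum_{n\ge1}s_n\,f_n\otimes g_n$ (strong convergence), where $(f\otimes g)(h)=\langle h,g\rangle f$. *)

(* Defs.v *)
From HB Require Import structures.
From mathcomp Require Import all_boot all_order all_algebra.
From mathcomp Require Import complex.
From mathcomp Require Import all_classical all_reals.
From mathcomp Require Import ereal topology normedtype sequences esum.
From mathcomp Require Import ring.
Set Implicit Arguments.
Unset Strict Implicit.
Unset Printing Implicit Defensive.
Import Order.TTheory GRing.Theory Num.Theory.
Import numFieldNormedType.Exports.
Local Open Scope classical_set_scope.
Local Open Scope complex_scope.
Local Open Scope ring_scope.

(* Complex Hilbert spaces; [inner] is linear in its first argument. *)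
HB.mixin Record isHilbert (R : realType) V & CompleteNormedModule R[i] V := {
  inner : {dot V for (@Num.conj R[i])} ;
  inner_norm : forall x : V, inner x x = `|x| ^+ 2
}.

#[short(type="hilbertType")]
HB.structure Definition Hilbert (R : realType) :=
  {V of CompleteNormedModule R[i] V & isHilbert R V}.

(* The norm of a normed module over R[i] takes its values in R[i]. *)
Definition rnorm (R : realType) (V : normedModType R[i]) (x : V) : R :=
  complex.Re `|x|.

Section DotFacts.
Context (R : realType) (U : lmodType R[i]) (f : {dot U for (@Num.conj R[i])}).

Lemma dot_CauchySchwarz (u v : U) : `|f u v| ^+ 2 <= f u u * f v v.
Proof.
have [->|v0] := eqVneq v 0.
  by rewrite linear0r normr0 expr0n /= linear0r mulr0.
have fv0 : 0 < f v v by rewrite dnorm_gt0.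
have fvC : (f v v)^*%R = f v v by apply/CrealP/ger0_real/ltW.
have := dnorm_ge0 f (u - (f u v / f v v) *: v).
rewrite dnormB dnormZ linearZr_LR /=.
rewrite rmorphM fmorphV /= fvC.
rewrite normrM normfV (gtr0_norm fv0).
have -> : (f u v)^*%R / f v v * f u v = `|f u v| ^+ 2 / f v v.
  by rewrite normCKC mulrAC.
have nC : (`|f u v| ^+ 2 / f v v)^*%R = `|f u v| ^+ 2 / f v v.
  by apply/CrealP/ger0_real; rewrite divr_ge0 ?exprn_ge0// ltW.
rewrite nC expr_div_n -mulrA (expr2 (f v v)) invfM mulrA mulrA divfK ?gt_eqF//.
rewrite opprD addrACA subrr addr0 subr_ge0.
by rewrite ler_pdivrMr.
Qed.

Lemma dot_norm_triangle (u v : U) :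
  sqrtC (f (u + v) (u + v)) <= sqrtC (f u u) + sqrtC (f v v).
Proof.
rewrite -(@ler_pXn2r _ 2) ?nnegrE ?addr_ge0 ?sqrtC_ge0 ?dnorm_ge0//.
rewrite sqrrD !sqrtCK dnormD /=.
rewrite [leRHS]addrAC lerD2l.
have -> : f u v + (f u v)^*%R = 'Re (f u v) *+ 2.
  by rewrite -[RHS]mulr_natr ReE divfK// pnatr_eq0.
rewrite ler_wMn2r//.
apply: (le_trans (leif_Re_Creal _)).
rewrite -(@ler_pXn2r _ 2) ?nnegrE ?mulr_ge0 ?sqrtC_ge0 ?dnorm_ge0//.
by rewrite exprMn !sqrtCK; exact: dot_CauchySchwarz.
Qed.
End DotFacts.

Section ComplexLimits.
Context (R : realType).
Implicit Types (u : nat -> R) (z : nat -> R[i]^o).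

Lemma Re_norm_ge0 (V : normedModType R[i]) (x : V) : 0 <= rnorm x.
Proof. by rewrite /rnorm; have := normr_ge0 x; rewrite lecE => /andP[]. Qed.

Lemma rnormE (V : normedModType R[i]) (x : V) : `|x| = (rnorm x)%:C.
Proof. by rewrite /rnorm RRe_real// normr_real. Qed.

Lemma cvgn_real_complex u (l : R) :
  u @ \oo --> l -> (fun n => (u n)%:C : R[i]^o) @ \oo --> (l%:C : R[i]^o).
Proof.
move=> ul; apply/cvgrPdist_lt => e e0.
have eE : e = (complex.Re e)%:C by rewrite RRe_real// gtr0_real.
have re0 : 0 < complex.Re e by rewrite -ltcR -eE.
move/cvgrPdist_lt : ul => /(_ _ re0); apply: filterS => n.
by rewrite -rmorphB normc_def /= expr0n addr0 sqrtr_sqr => h; rewrite eE ltcR.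
Qed.

Lemma cvgn_complexP z : cvgn (fun n => complex.Re (z n)) ->
  cvgn (fun n => complex.Im (z n)) -> cvgn z.
Proof.
move=> /cvgn_real_complex cr /cvgn_real_complex ci.
have -> : z = (fun n => (complex.Re (z n))%:C + 'i%C * (complex.Im (z n))%:C).
  by apply/funext => n; exact: complexE.
by apply/cvg_ex; eexists; apply: cvgD; [exact: cr | apply: cvgMr; exact: ci].
Qed.

Lemma cvgn_conj z (l : R[i]^o) : z @ \oo --> l ->
  (fun n => (z n)^*%R : R[i]^o) @ \oo --> (l^*%R : R[i]^o).
Proof.
move=> zl; apply/cvgrPdist_lt => e e0.
move/cvgrPdist_lt : zl => /(_ _ e0); apply: filterS => n.
by rewrite -rmorphB norm_conjC.
Qed.

Lemma limnC_unique z (l : R[i]^o) : z @ \oo --> l -> limn z = l.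
Proof. by move=> zl; apply: cvg_lim => //; exact: norm_hausdorff. Qed.

End ComplexLimits.

(* Symmetric partial sums over the integers: \sum_(- n <= i < n) g i, since
   Negz k is - (k + 1). *)
Definition zpsum (W : nmodType) (g : int -> W) (n : nat) : W :=
  \sum_(0 <= k < n) (g (Posz k) + g (Negz k)).

Section ZSums.
Context (R : realType).

Lemma zpsumD (W : nmodType) (g h : int -> W) n :
  zpsum (fun i => g i + h i) n = zpsum g n + zpsum h n.
Proof. by rewrite /zpsum -big_split /=; apply: eq_bigr => k _; rewrite addrACA. Qed.

Lemma zpsumZ (K : pzRingType) (c : K) (g : int -> K) n :
  zpsum (fun i => c * g i) n = c * zpsum g n.
Proof. by rewrite /zpsum mulr_sumr; apply: eq_bigr => k _; rewrite mulrDr. Qed.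

Lemma zpsum_morph (W W' : nmodType) (phi : {additive W -> W'}) (g : int -> W) n :
  phi (zpsum g n) = zpsum (fun i => phi (g i)) n.
Proof. by rewrite /zpsum raddf_sum; apply: eq_bigr => k _; rewrite raddfD. Qed.

Lemma le_zpsum (g h : int -> R) n : (forall i, g i <= h i) ->
  zpsum g n <= zpsum h n.
Proof. by move=> gh; apply: ler_sum => k _; exact: lerD. Qed.

Lemma zpsum_ge0 (g : int -> R) n : (forall i, 0 <= g i) -> 0 <= zpsum g n.
Proof. by move=> g0; apply: sumr_ge0 => k _; exact: addr_ge0. Qed.

Lemma nondecreasing_zpsum (g : int -> R) : (forall i, 0 <= g i) ->
  nondecreasing_seq (zpsum g).
Proof.
move=> g0; apply/nondecreasing_seqP => n.
by rewrite /zpsum big_nat_recr//= lerDl addr_ge0.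
Qed.

Lemma zpsum_term (g : int -> R) (i : int) : (forall i, 0 <= g i) ->
  exists n, g i <= zpsum g n.
Proof.
move=> g0; case: i => k; exists k.+1; rewrite /zpsum big_nat_recr//= -/(zpsum _ _).
- by rewrite addrCA lerDl addr_ge0// zpsum_ge0.
- by rewrite addrA lerDr addr_ge0// zpsum_ge0.
Qed.

Lemma cvg_zpsum_nneg (g : int -> R) (M : R) : (forall i, 0 <= g i) ->
  (forall n, zpsum g n <= M) -> cvgn (zpsum g).
Proof.
move=> g0 gM; apply: nondecreasing_is_cvgn; first exact: nondecreasing_zpsum.
by exists M => _ [n _ <-].
Qed.

Lemma cvg_zpsum_abs (g : int -> R) (M : R) :
  (forall n, zpsum (fun i => `|g i|) n <= M) -> cvgn (zpsum g).
Proof.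
move=> gM.
have -> : zpsum g = (fun n => zpsum (fun i => `|g i| + g i) n
                            - zpsum (fun i => `|g i|) n).
  by apply/funext => n; rewrite zpsumD addrC addKr.
apply: is_cvgB; last exact: (@cvg_zpsum_nneg _ M).
apply: (@cvg_zpsum_nneg _ (M + M)) => [i|n].
  by rewrite -lerBlDr sub0r -normrN ler_norm.
rewrite zpsumD; apply: lerD => //; apply: le_trans (gM n).
by apply: le_zpsum => i; exact: ler_norm.
Qed.

Lemma cvg_zpsum_complex (g : int -> R[i]) (M : R) :
  (forall n, zpsum (fun i => complex.Re `|g i|) n <= M) ->
  cvgn (zpsum g : nat -> R[i]^o).
Proof.
move=> gM; apply: cvgn_complexP.
- have -> : (fun n => complex.Re (zpsum g n)) = zpsum (fun i => complex.Re (g i)).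
    by apply/funext => n; rewrite -(zpsum_morph (@complex.Re R : {additive _ -> _})).
  apply: (@cvg_zpsum_abs _ M) => n; apply: le_trans (gM n).
  apply: le_zpsum => i; rewrite -lecR RRe_real ?normr_real//; exact: normc_ge_Re.
- have -> : (fun n => complex.Im (zpsum g n)) = zpsum (fun i => complex.Im (g i)).
    by apply/funext => n; rewrite -(zpsum_morph (@complex.Im R : {additive _ -> _})).
  apply: (@cvg_zpsum_abs _ M) => n; apply: le_trans (gM n).
  apply: le_zpsum => i; rewrite -lecR RRe_real ?normr_real// normc_def lecR -sqrtr_sqr.
  by rewrite ler_wsqrtr// lerDr sqr_ge0.
Qed.

Lemma esum_zpsumP (g : int -> R) : (forall i, 0 <= g i) ->
  (\esum_(i in [set: int]) (g i)%:E < +oo)%E <->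
  exists M : R, forall n, zpsum g n <= M.
Proof.
move=> g0.
pose s n := [seq Posz k | k <- index_iota 0 n] ++ [seq Negz k | k <- index_iota 0 n].
have us n : uniq (s n).
  rewrite cat_uniq !map_inj_uniq ?iota_uniq/= ?andbT => [|? ? []//|? ? []//].
  by apply/hasPn => _ /mapP[k _ ->]; apply/mapP => -[].
have sE n : (zpsum g n)%:E = (\sum_(i \in [set` s n]) (g i)%:E)%E.
  rewrite -fsbig_seq// big_cat !big_map /zpsum big_split EFinD.
  by rewrite -!sumEFin.
split.
  move=> goo.
  have g0' : (0 <= \esum_(i in [set: int]) (g i)%:E)%E.
    by apply: esum_ge0 => i _; rewrite lee_fin.
  exists (fine (\esum_(i in [set: int]) (g i)%:E)%E) => n.
  rewrite -lee_fin fineK ?ge0_fin_numE// sE.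
  by apply: esum_ge; exists [set` s n] => //; split => //; exact: finite_seq.
move=> [M gM]; apply: (@le_lt_trans _ _ M%:E); last exact: ltry.
apply: ge_ereal_sup => _ [A [finA _] <-].
have [r rA] : exists r : seq int, A = [set` r] by apply/finite_seqP.
have [n rn] : exists n, forall i, i \in r -> (`|i| < n)%N.
  exists (\max_(i <- r) `|i|%N).+1 => i ir.
  by rewrite ltnS; exact: (@leq_bigmax_seq _ _ xpredT absz).
apply: (@le_trans _ _ (zpsum g n)%:E); last by rewrite lee_fin.
rewrite sE; apply: lee_fsum_nneg_subset => //; first exact: finite_seq.
- move=> i; rewrite !inE rA /= => ir.
  have {ir} := rn _ ir.
  rewrite mem_cat; case: i => k /= kn; apply/orP; [left|right].
    by rewrite mem_map ?mem_index_iota// => ? ? [].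
  by rewrite mem_map ?mem_index_iota /= 1?ltnW// => ? ? [].
- by move=> t _; rewrite lee_fin.
Qed.

End ZSums.
(* hsumZ V is the Hilbert direct sum of copies of V indexed by int. *)
Section DirectSum.
Context (R : realType) (V : hilbertType R).

Definition square_summable : set (int -> V) :=
  [set x | (\esum_(i in [set: int]) (rnorm (x i) ^+ 2)%:E < +oo)%E].

Definition hsum_pred : {pred int -> V} := mem square_summable.

Record hsumZ := HsumZ { hsum_fun :> int -> V; hsum_funP : hsum_fun \in hsum_pred }.

HB.instance Definition _ := [isSub for hsum_fun].
HB.instance Definition _ := [Choice of hsumZ by <:].

Let sq (x : int -> V) (i : int) : R := rnorm (x i) ^+ 2.

Lemma square_summableP (x : int -> V) :
  square_summable x <-> exists M : R, forall n, zpsum (sq x) n <= M.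
Proof. by apply: esum_zpsumP => i; exact: sqr_ge0. Qed.

Lemma realCX (r : R) : (r ^+ 2)%:C = r%:C ^+ 2. Proof. exact: rmorphXn. Qed.

Lemma realCM (r s : R) : (r * s)%:C = r%:C * s%:C. Proof. exact: rmorphM. Qed.

Lemma cvg_rnorm (T : Type) (F : set_system T) (FF : Filter F) (g : T -> V) (l : V) :
  g @ F --> l -> rnorm (g t) @[t --> F] --> rnorm l.
Proof.
move=> gl; apply/cvgrPdist_lt => e e0.
have e0C : 0 < e%:C :> R[i] by rewrite ltcR.
move/cvgrPdist_lt : gl => /(_ _ e0C); apply: filterS => t.
rewrite rnormE ltcR; apply: le_lt_trans.
have rB (u v : V) : rnorm u - rnorm v <= rnorm (u - v).
  rewrite lerBlDr -lecR [leRHS]rmorphD /= -!rnormE.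
  by have := ler_normD (u - v) v; rewrite subrK.
rewrite ler_norml rB andbT lerNl opprB (le_trans (rB _ _))//.
by rewrite -lecR -!rnormE distrC.
Qed.

Lemma rnormD_sq (u v : V) :
  rnorm (u + v) ^+ 2 <= 2 * rnorm u ^+ 2 + 2 * rnorm v ^+ 2.
Proof.
have h : rnorm (u + v) <= rnorm u + rnorm v.
  by rewrite -lecR rmorphD /= -!rnormE ler_normD.
apply: (@le_trans _ _ ((rnorm u + rnorm v) ^+ 2)).
  by rewrite ler_pXn2r ?nnegrE ?addr_ge0 ?Re_norm_ge0.
rewrite -subr_ge0.
have -> : 2 * rnorm u ^+ 2 + 2 * rnorm v ^+ 2 - (rnorm u + rnorm v) ^+ 2 =
          (rnorm u - rnorm v) ^+ 2.
  by ring.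
exact: sqr_ge0.
Qed.

Lemma rnormZ (a : R[i]) (u : V) : rnorm (a *: u) = complex.Re `|a| * rnorm u.
Proof.
apply: complexI; rewrite rmorphM /= -!rnormE normrZ /=.
by congr (_ * _); rewrite RRe_real ?normr_real.
Qed.

Lemma hsum_submod_closed : submod_closed hsum_pred.
Proof.
split.
  apply/mem_set/square_summableP; exists 0 => n.
  by rewrite /zpsum big1// => k _; rewrite /sq /rnorm normr0 expr0n addr0.
move=> a x y /set_mem/square_summableP[M xM] /set_mem/square_summableP[N yN].
apply/mem_set/square_summableP.
pose c := 2 * complex.Re `|a| ^+ 2.
exists (c * M + 2 * N) => n.
apply: (@le_trans _ _ (zpsum (fun i => c * sq x i + 2 * sq y i) n)).
  apply: le_zpsum => i; apply: (le_trans (rnormD_sq _ _)).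
  by rewrite rnormZ exprMn mulrA.
rewrite zpsumD !zpsumZ; apply: lerD; apply: ler_wpM2l => //.
by rewrite mulr_ge0 ?sqr_ge0.
Qed.

HB.instance Definition _ :=
  GRing.isSubmodClosed.Build _ _ hsum_pred hsum_submod_closed.
HB.instance Definition _ := [SubChoice_isSubLmodule of hsumZ by <:].

Implicit Types x y z : hsumZ.

(* In [(x + y) i] the coercion to functions is inserted inside the sum, hence
   the explicit [hsum_fun]. *)
Lemma hsumDE x y i : hsum_fun (x + y) i = x i + y i. Proof. by []. Qed.
Lemma hsumNE x i : hsum_fun (- x) i = - x i. Proof. by []. Qed.
Lemma hsumBE x y i : hsum_fun (x - y) i = x i - y i. Proof. by []. Qed.
Lemma hsumZE (a : R[i]) x i : hsum_fun (a *: x) i = a *: x i. Proof. by []. Qed.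
Lemma hsum0E i : (0 : hsumZ) i = 0. Proof. by []. Qed.

Lemma hsum_eqP x y : (forall i, x i = y i) -> x = y.
Proof. by move=> xy; apply: val_inj; apply/funext. Qed.

Definition hsum_inner x y : R[i] :=
  limn (zpsum (fun i => inner (x i) (y i)) : nat -> R[i]^o).

Lemma hsum_inner_cvg x y :
  (zpsum (fun i => inner (x i) (y i)) : nat -> R[i]^o) @ \oo --> (hsum_inner x y : R[i]^o).
Proof.
have /set_mem/square_summableP[M xM] := hsum_funP x.
have /set_mem/square_summableP[N yN] := hsum_funP y.
apply: (@cvg_zpsum_complex _ _ (M + N)) => n.
apply: le_trans (lerD (xM n) (yN n)); rewrite -zpsumD.
apply: le_zpsum => i.
have h : complex.Re `|inner (x i) (y i)| ^+ 2 <= sq x i * sq y i.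
  rewrite -lecR realCX realCM /sq !realCX.
  rewrite (RRe_real (normr_real _)) -2!rnormE -2!inner_norm.
  exact: dot_CauchySchwarz.
have q0 u (k : int) : 0 <= sq u k by exact: sqr_ge0.
rewrite -(@ler_pXn2r _ 2) ?nnegrE ?addr_ge0 ?q0//; last first.
  by rewrite -ler0c (RRe_real (normr_real _)).
apply: (le_trans h); rewrite sqrrD.
rewrite -subr_ge0 (_ : _ - _ = sq x i ^+ 2 + sq y i ^+ 2 + sq x i * sq y i); last first.
  by ring.
by apply: addr_ge0; [apply: addr_ge0; exact: sqr_ge0|exact: mulr_ge0].
Qed.

Lemma hsum_inner_unique x y (l : R[i]^o) :
  (zpsum (fun i => inner (x i) (y i)) : nat -> R[i]^o) @ \oo --> l ->
  hsum_inner x y = l.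
Proof. exact: limnC_unique. Qed.

Lemma hsum_innerC x y : hsum_inner x y = (-1) ^+ false * (hsum_inner y x)^*%R.
Proof.
rewrite expr0 mul1r; apply: hsum_inner_unique.
have -> : zpsum (fun i => inner (x i) (y i)) =
          (fun n => (zpsum (fun i => inner (y i) (x i)) n)^*%R).
  apply/funext => n; rewrite [RHS](zpsum_morph (@Num.conj R[i])).
  by congr (zpsum _ n); apply/funext => i; rewrite hermC expr0 mul1r.
by apply: cvgn_conj; exact: hsum_inner_cvg.
Qed.

Lemma hsum_innerDZl y a x x' :
  hsum_inner (a *: x + x') y = a * hsum_inner x y + hsum_inner x' y.
Proof.
apply: hsum_inner_unique.
have -> : zpsum (fun i => inner (hsum_fun (a *: x + x') i) (y i)) =
   (fun n => a * zpsum (fun i => inner (x i) (y i)) n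
             + zpsum (fun i => inner (x' i) (y i)) n).
  apply/funext => n; rewrite -zpsumZ -zpsumD.
  congr (zpsum _ n); apply/funext => i.
  by rewrite hsumDE hsumZE linearDl linearZl_LR.
by apply: cvgD; [apply: cvgMr|]; exact: hsum_inner_cvg.
Qed.

Lemma hsum_inner_bilinear :
  bilinear_for ( *%R ) ((@Num.conj R[i]) \; *%R) hsum_inner.
Proof.
split => [y a x x'|x a y y']; first exact: hsum_innerDZl.
rewrite hsum_innerC hsum_innerDZl expr0 mul1r rmorphD rmorphM /=.
by rewrite [hsum_inner x y]hsum_innerC [hsum_inner x y']hsum_innerC !expr0 !mul1r.
Qed.

HB.instance Definition _ := bilinear_isBilinear.Build R[i] hsumZ hsumZ R[i]
  ( *%R ) ((@Num.conj R[i]) \; *%R) hsum_inner hsum_inner_bilinear.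
HB.instance Definition _ := isHermitianSesquilinear.Build R[i] hsumZ false
  (@Num.conj R[i]) hsum_inner hsum_innerC.

Lemma sq_cvg x : cvgn (zpsum (sq x)).
Proof.
have /set_mem/square_summableP[M xM] := hsum_funP x.
by apply: (@cvg_zpsum_nneg _ _ M) => // i; exact: sqr_ge0.
Qed.

Lemma hsum_innerxx x : hsum_inner x x = (limn (zpsum (sq x)))%:C.
Proof.
apply: hsum_inner_unique.
have -> : zpsum (fun i => inner (x i) (x i)) = (fun n => (zpsum (sq x) n)%:C).
  apply/funext => n; rewrite [RHS](zpsum_morph (real_complex R)).
  congr (zpsum _ n); apply/funext => i.
  by rewrite inner_norm rnormE -rmorphXn.
by apply: cvgn_real_complex; exact: sq_cvg.
Qed.

Lemma zpsum_le_limn x n : zpsum (sq x) n <= limn (zpsum (sq x)).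
Proof.
apply: nondecreasing_cvgn_le; last exact: sq_cvg.
by apply: nondecreasing_zpsum => i; exact: sqr_ge0.
Qed.

Lemma hsum_inner_gt0 x : x != 0 -> 0 < hsum_inner x x.
Proof.
move=> x0; rewrite hsum_innerxx ltcR.
have [i xi0] : exists i, x i != 0.
  apply: contrapT => h; move/eqP : x0; apply; apply: hsum_eqP => i.
  by apply/eqP; apply: contrapT => xi; apply: h; exists i; apply/negP.
have [n hn] := @zpsum_term _ (sq x) i (fun i => sqr_ge0 _).
apply: lt_le_trans (le_trans hn (zpsum_le_limn x n)).
rewrite exprn_gt0// lt_neqAle Re_norm_ge0 andbT eq_sym.
by apply: contra xi0 => /eqP r0; rewrite -normr_eq0 rnormE r0.
Qed.

HB.instance Definition _ := isDotProduct.Build R[i] hsumZ hsum_inner hsum_inner_gt0.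

Definition hsum_norm x : R[i] := sqrtC (hsum_inner x x).

Lemma hsum_normD x y : hsum_norm (x + y) <= hsum_norm x + hsum_norm y.
Proof. exact: (dot_norm_triangle hsum_inner). Qed.

Lemma hsum_normZ a x : hsum_norm (a *: x) = `|a| * hsum_norm x.
Proof.
rewrite /hsum_norm (dnormZ hsum_inner) sqrtCM ?nnegrE ?exprn_ge0 ?dnorm_ge0//.
by rewrite sqrCK.
Qed.

Lemma hsum_norm0 x : hsum_norm x = 0 -> x = 0.
Proof.
by move/eqP; rewrite sqrtC_eq0 => x0; apply/eqP; rewrite -(dnorm_eq0 hsum_inner).
Qed.

HB.instance Definition _ :=
  Lmodule_isNormed.Build R[i] hsumZ hsum_normD hsum_normZ hsum_norm0.

Lemma hsum_normE x : hsum_inner x x = `|x| ^+ 2.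
Proof. by rewrite (_ : `|x| = hsum_norm x)// /hsum_norm sqrtCK. Qed.

Lemma hsum_rnormE x : rnorm x ^+ 2 = limn (zpsum (sq x)).
Proof. by apply: complexI; rewrite -hsum_innerxx hsum_normE rnormE realCX. Qed.

Lemma zpsum_le_rnorm x n : zpsum (sq x) n <= rnorm x ^+ 2.
Proof. by rewrite hsum_rnormE zpsum_le_limn. Qed.

Lemma rnorm_le_zpsum x (M : R) : (forall n, zpsum (sq x) n <= M) ->
  rnorm x ^+ 2 <= M.
Proof.
move=> xM; rewrite hsum_rnormE; apply: limr_le; first exact: sq_cvg.
by apply: nearW.
Qed.

Lemma hsum_coord_le x i : `|x i| <= `|x|.
Proof.
rewrite !rnormE lecR -(@ler_pXn2r _ 2) ?nnegrE ?Re_norm_ge0//.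
have [n hn] := @zpsum_term _ (sq x) i (fun i => sqr_ge0 _).
exact: le_trans hn (zpsum_le_rnorm x n).
Qed.

Lemma hsum_complete (F : set_system hsumZ) :
  ProperFilter F -> cauchy F -> cvg F.
Proof.
move=> FF /cauchyP Fc.
have Gc i : cvg ((fun x : hsumZ => x i) @ F).
  apply: cauchy_cvg; apply/cauchyP => e e0.
  have [x0 Fx0] := Fc e e0; exists (x0 i).
  suff : F [set x : hsumZ | ball (x0 i) e (x i)] by [].
  apply: filterS Fx0 => x; rewrite -!ball_normE /= => h.
    exact: le_lt_trans (hsum_coord_le (x0 - x) i) h.
pose y i := lim ((fun x : hsumZ => x i) @ F).
have Gy i : (fun x : hsumZ => x i) @ F --> y i by exact: Gc.
have near_y (x0 : hsumZ) (e : R) : 0 < e -> F (ball x0 e%:C) ->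
    forall n, zpsum (sq (fun i => x0 i - y i)) n <= e ^+ 2.
  move=> e0 Fx0 n.
  have cy : zpsum (sq (hsum_fun (x0 - x))) n @[x --> F] -->
      zpsum (sq (fun i => x0 i - y i)) n.
    have ci i : sq (hsum_fun (x0 - x)) i @[x --> F] -->
        sq (fun i => x0 i - y i) i.
      by apply: cvgM; apply: cvg_rnorm; apply: cvgB;
        [exact: cvg_cst|exact: Gy|exact: cvg_cst|exact: Gy].
    elim: n => [|n IH].
      rewrite /zpsum big_nil; under eq_fun do rewrite big_nil.
      exact: cvg_cst.
    rewrite /zpsum big_nat_recr//=; under eq_fun do rewrite big_nat_recr//=.
    by apply: cvgD => //; apply: cvgD.
  apply: (closed_cvg (fun t => t <= e ^+ 2) _ _ _ cy).
    exact: closed_le.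
  apply: filterS Fx0 => x; rewrite -ball_normE /= rnormE ltcR => h.
  apply: (le_trans (zpsum_le_rnorm (x0 - x) n)).
  by rewrite ler_pXn2r ?nnegrE ?Re_norm_ge0 ?ltW.
have [x0 Fx0] := Fc 1 ltr01.
have y2 : y \in hsum_pred.
  have d2 : (fun i => x0 i - y i) \in hsum_pred.
    apply/mem_set/square_summableP; exists (1 ^+ 2) => n.
    exact: near_y.
  have -> : y = (x0 : int -> V) - (fun i => x0 i - y i).
    by apply/funext => i; rewrite /GRing.add/= /GRing.opp/= opprB addrC subrK.
  by rewrite rpredB// hsum_funP.
apply/cvg_ex; exists (HsumZ y2); apply/cvgrPdist_le => e e0.
have eE : e = (complex.Re e)%:C by rewrite RRe_real// gtr0_real.
have re0 : 0 < complex.Re e by rewrite -ltcR -eE.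
have re20 : 0 < complex.Re e / 2 by rewrite divr_gt0.
have e20 : 0 < (complex.Re e / 2)%:C by rewrite ltcR.
have [z Fz] := Fc _ e20.
have zy : `|z - HsumZ y2| <= (complex.Re e / 2)%:C.
  rewrite rnormE lecR -(@ler_pXn2r _ 2) ?nnegrE ?Re_norm_ge0 ?(ltW re20)//.
  by apply: rnorm_le_zpsum => n; exact: near_y.
apply: filterS Fz => x; rewrite -ball_normE /= => zx.
rewrite -(subrK z (HsumZ y2)) -addrA eE [complex.Re e]splitr rmorphD.
by apply: (le_trans (ler_normD _ _)); apply: lerD; [rewrite distrC|exact: ltW].
Qed.

HB.instance Definition _ := Uniform_isComplete.Build hsumZ hsum_complete.

HB.instance Definition _ := isHilbert.Build R hsumZ hsum_normE.

End DirectSum.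
Section Operators.
Context (R : realType) (V : hilbertType R).
Implicit Types T P D : {linear V -> V}.

Definition op_norm T : \bar R :=
  ereal_sup [set (rnorm (T x))%:E | x in [set x : V | rnorm x <= 1]].

Definition contraction T := (op_norm T <= 1)%E.

Definition is_adjoint T T' := forall x y : V, inner (T x) y = inner x (T' y).

(* The adjoint exists and is unique when T is bounded; the default value 0 is
   only taken by operators without an everywhere defined adjoint. *)
Definition adjoint T : {linear V -> V} := xget (\0 : {linear V -> V}) [set T' | is_adjoint T T'].

Definition positive_op P := forall x : V, 0 <= inner (P x) x.

Definition is_sqrt_op P D :=
  [/\ continuous D, positive_op D & forall x : V, D (D x) = P x].

(* The square root exists and is unique when P is bounded and positive. *)
Definition sqrt_op P : {linear V -> V} := xget (\0 : {linear V -> V}) [set D | is_sqrt_op P D].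

(* D_T = (1 - T^* T)^(1/2) *)
Definition defect_op T : {linear V -> V} := sqrt_op (idfun \- (adjoint T \o T)).

Definition eigenvector (T : V -> V) (v : V) :=
  v != 0 /\ exists l : R[i], T v = l *: v.

Definition linear_span (B : set V) : set V :=
  [set x | exists (n : nat) (c : 'I_n -> R[i]) (b : 'I_n -> V),
    (forall k, B (b k)) /\ x = \sum_(k < n) c k *: b k].

Definition orthonormal_basis (B : set V) :=
  (forall u v, B u -> B v -> inner u v = (u == v)%:R) /\
  closure (linear_span B) = [set: V].

Definition diagonalizable_op (T : V -> V) :=
  exists B : set V, orthonormal_basis B /\ (forall v, B v -> eigenvector T v).

(* [index_range (Some m)] is {0, ..., m - 1} and [index_range None] is nat, so
   that families indexed by [index_range N] are the finite or countable ones. *)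
Definition index_range (N : option nat) : pred nat :=
  fun n => if N is Some m then (n < m)%N else true.

Definition orthonormal_system (N : option nat) (f : nat -> V) :=
  forall i j, index_range N i -> index_range N j -> inner (f i) (f j) = (i == j)%:R.

Definition rank_one (f g h : V) : V := inner h g *: f.

Definition schmidt_decomposable T :=
  exists (N : option nat) (f g : nat -> V) (s : nat -> R),
    [/\ orthonormal_system N f, orthonormal_system N g,
        (forall n, index_range N n -> 0 < s n) &
        forall h : V,
          (fun m => \sum_(0 <= n < m | index_range N n)
                      (s n)%:C *: rank_one (f n) (g n) h) @ \oo --> T h].

End Operators.

Definition separable_space (X : topologicalType) :=
  exists D : set X, countable D /\ dense D.

Section Dilation.
Context (R : realType) (V : hilbertType R).

Lemma hsum_pred_shift (c : int) (x : int -> V) :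
  x \in @hsum_pred R V -> (fun i => x (i + c)) \in @hsum_pred R V.
Proof.
move=> /set_mem xs; apply/mem_set.
rewrite /square_summable /= in xs *.
rewrite (@reindex_esum R int int setT setT (fun i => i + c)
  (fun i => (rnorm (x i) ^+ 2)%:E)) in xs => //.
split => //=.
- by move=> i j _ _; exact: addIr.
- by move=> i _; exists (i - c); rewrite ?subrK.
Qed.

Lemma hsum_pred_finite (n : nat) (x : int -> V) :
  (forall k, (n <= k)%N -> x (Posz k) = 0 /\ x (Negz k) = 0) ->
  x \in @hsum_pred R V.
Proof.
move=> x0; apply/mem_set/square_summableP.
exists (zpsum (fun i => rnorm (x i) ^+ 2) n) => m.
have nE p : zpsum (fun i => rnorm (x i) ^+ 2) (n + p)%N =
            zpsum (fun i => rnorm (x i) ^+ 2) n.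
  elim: p => [|p IH]; first by rewrite addn0.
  rewrite addnS -IH [LHS]/zpsum big_nat_recr//=.
  have [-> ->] := x0 _ (leq_addr p n).
  by rewrite /rnorm normr0 expr0n !addr0.
rewrite -(nE m); apply: nondecreasing_zpsum; last exact: leq_addl.
by move=> i; exact: sqr_ge0.
Qed.

Definition bishift_fun (x : int -> V) (i : int) : V := x (i - 1).

Lemma bishift_subproof (x : hsumZ V) : bishift_fun x \in @hsum_pred R V.
Proof. by apply: hsum_pred_shift; exact: hsum_funP. Qed.

Definition bishift (x : hsumZ V) : hsumZ V := HsumZ (bishift_subproof x).

Lemma bishift_is_linear : linear bishift.
Proof. by move=> a x y; apply: hsum_eqP. Qed.

HB.instance Definition _ :=
  GRing.isLinear.Build R[i] (hsumZ V) (hsumZ V) *:%R bishift bishift_is_linear.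

Variable A : {linear V -> V}.

(* The entry from the j-th to the i-th summand of the unitary dilation of a
   contraction A. *)
Definition dilation_entry (i j : int) : {linear V -> V} :=
  if (i == 0) && (j == 0) then A
  else if (i == 0) && (j == 1) then defect_op (adjoint A)
  else if (i == -1) && (j == 0) then defect_op A
  else if (i == -1) && (j == 1) then (\- adjoint A : {linear V -> V})
  else if [&& i != 0, i != -1 & j == i + 1] then (idfun : {linear V -> V})
  else (\0 : {linear V -> V}).

Lemma dilation_entry_band (i j : int) (v : V) :
  j \notin [:: i; i + 1; i + 2] -> dilation_entry i j v = 0.
Proof.
rewrite !inE !negb_or /dilation_entry => /and3P[j0 j1 j2].
have [i0|i0] := eqVneq i 0.
  by move: j0 j1; rewrite i0 add0r => /negPf-> /negPf->.
have [i1|i1] := eqVneq i (-1); last by rewrite (negPf j1) andbF.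
by move: j1 j2; rewrite i1 addNr => /negPf-> /negPf->.
Qed.

(* The matrix is zero outside of the band i <= j <= i + 2. *)
Definition dilation_fun (x : int -> V) (i : int) : V :=
  \sum_(j <- [:: i; i + 1; i + 2]) dilation_entry i j (x j).

Lemma dilation_funE (x : int -> V) (i : int) : dilation_fun x i =
  if i == 0 then A (x 0) + defect_op (adjoint A) (x 1)
  else if i == -1 then defect_op A (x 0) - adjoint A (x 1)
  else x (i + 1).
Proof.
rewrite /dilation_fun !big_cons big_nil addr0 /dilation_entry.
have [->|i0] := eqVneq i 0; first by rewrite !add0r /= addr0.
have [->|i1] := eqVneq i (-1); first by rewrite addNr /= add0r.
have h0 : (i == i + 1) = false by rewrite eq_sym -subr_eq0 addrAC subrr.
have h2 : (i + 2 == i + 1) = false by rewrite (inj_eq (addrI i)).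
by rewrite h0 h2 eqxx /= add0r addr0.
Qed.

Lemma dilation_subproof (x : hsumZ V) : dilation_fun x \in @hsum_pred R V.
Proof.
have -> : dilation_fun x = (fun i => x (i + 1)) + (fun i => dilation_fun x i - x (i + 1)).
  by apply/funext => i; rewrite [RHS]addrC subrK.
apply: rpredD; first by apply: hsum_pred_shift; exact: hsum_funP.
apply: (@hsum_pred_finite 1) => -[|k]// _.
by split; rewrite dilation_funE /= subrr.
Qed.

Definition dilation (x : hsumZ V) : hsumZ V := HsumZ (dilation_subproof x).

Lemma dilation_is_linear : linear dilation.
Proof.
move=> a x y; apply: hsum_eqP => i.
rewrite hsumDE hsumZE /= /dilation_fun scaler_sumr -big_split /=.
by apply: eq_bigr => j _; rewrite linearP.
Qed.

HB.instance Definition _ :=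
  GRing.isLinear.Build R[i] (hsumZ V) (hsumZ V) *:%R dilation dilation_is_linear.

Lemma hsum_single_subproof (j : int) (v : V) :
  (fun i => if i == j then v else 0) \in @hsum_pred R V.
Proof.
apply: (@hsum_pred_finite `|j|.+1) => k jk; split; case: eqP => // kj;
  by move: jk; rewrite -kj /= ltnNge ?leqnSn ?leqnn.
Qed.

(* The vector of the direct sum with entry v at j and 0 elsewhere. *)
Definition hsum_single (j : int) (v : V) : hsumZ V :=
  HsumZ (hsum_single_subproof j v).

Lemma dilation_matrix (i j : int) (v : V) :
  dilation (hsum_single j v) i = dilation_entry i j v.
Proof.
rewrite /= /dilation_fun /=.
have [jb|jb] := boolP (j \in [:: i; i + 1; i + 2]); last first.
  rewrite dilation_entry_band// big1_seq// => k /= kb.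
  by case: eqP => [kj|]; [rewrite kj (negPf jb) in kb|rewrite linear0].
have ub : uniq [:: i; i + 1; i + 2].
  rewrite /= !inE !negb_or !andbT (inj_eq (addrI i)) /= andbT.
  have iN (k : int) : k != 0 -> i != i + k.
    by move=> k0; rewrite -{1}(addr0 i) (inj_eq (addrI i)) eq_sym.
  by rewrite !iN.
rewrite (bigD1_seq j)//= eqxx big1_seq ?addr0// => k /andP[/negPf-> _].
by rewrite linear0.
Qed.

End Dilation.

(* Main.v *)
From Pilot Require Import Defs.
From HB Require Import structures.
From mathcomp Require Import all_boot all_order all_algebra complex.
From mathcomp Require Import all_classical all_reals.
From mathcomp Require Import ereal topology normedtype sequences.
From mathcomp Require Import ring lra.
Set Implicit Arguments.
Unset Strict Implicit.
Unset Printing Implicit Defensive.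
Import Pilot.Defs.
Import Order.TTheory GRing.Theory Num.Theory.
Import numFieldNormedType.Exports.
Local Open Scope classical_set_scope.
Local Open Scope complex_scope.
Local Open Scope ring_scope.

(** The product of the bilateral shift and the dilation is the identity in all
    coordinates except 0 and 1, where it is the unitary block
    [(x0, x1) |-> (D x0 - A^* x1, A x0 + E x1)] with [D] and [E] the defect operators
    of [A] and [A^*] ([shift_dilationE]).

    If [A] has singular vectors [g_k], [f_k] and singular values [s_k], then
    [A g_k = s_k f_k], [A^* f_k = s_k g_k], and both [D g_k] and [E f_k] are
    multiples by [sqrt (1 - s_k^2)]; so [(g_k, i f_k)] and [(g_k, - i f_k)] are
    eigenvectors of the block.  A vector orthogonal to all of these has coordinates
    in the kernels of [A] and [A^*] and is fixed.  Hence every maximal orthonormal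
    set of eigenvectors containing them is a basis ([schmidt_diagonalizable]).

    Conversely, the relation [D A^* = A^* E] shows that the coordinate 0 of an
    eigenvector is zero or an eigenvector of [D], hence of [A^* A]
    ([shift_dilation_eigen]).  The eigenvectors of [A^* A] are therefore total, and
    for a self-adjoint operator this yields an orthonormal basis of eigenvectors
    ([selfadjoint_eigenbasis]).  Separability makes the part of it on which [A] does
    not vanish a finite or infinite sequence [g_n], and the normalised images [A g_n] complete a
    singular value decomposition ([eigenbasis_schmidt]).

    Both directions rest on three facts of Hilbert space theory.  Bounded
    functionals on a subspace are represented by a vector of its closure
    ([riesz_subspace]), which gives adjoints and orthogonal projections.  The
    positive square root of [1 - X], for a self-adjoint contraction [X], exists as
    a limit of polynomials in [X] and is unique among the positive contractions
    ([sqrt_op_ex], [sqrt_op_unique]); uniqueness is what makes [D A^* = A^* E] available for the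
    chosen roots.  An eigenvector of a squared positive operator for a
    square [mu^2], [mu >= 0], is an eigenvector of the operator itself
    ([positive_sqrt_eigen]). *)

(** * Inner products and norm limits *)

Section InnerProduct.
Context (R : realType) (V : hilbertType R).
Implicit Types x y z : V.

Lemma innerC x y : inner x y = (inner y x)^*%R.
Proof. by rewrite hermC expr0 mul1r. Qed.

Lemma innerZl (a : R[i]) x y : inner (a *: x) y = a * inner x y.
Proof. by rewrite linearZl_LR. Qed.

Lemma innerZr (a : R[i]) x y : inner x (a *: y) = a^*%R * inner x y.
Proof. by rewrite linearZr_LR. Qed.

Lemma innerxx x : inner x x = (rnorm x ^+ 2)%:C.
Proof. by rewrite inner_norm rnormE realCX. Qed.

Lemma inner_eq0C x y : inner x y = 0 -> inner y x = 0.
Proof. by move=> xy; rewrite innerC xy rmorph0. Qed.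

Lemma conj_realC (r : R) : (r%:C)^*%R = r%:C.
Proof. by apply/CrealP; rewrite complex_real. Qed.

Lemma rnorm_ge0 x : 0 <= rnorm x. Proof. exact: Re_norm_ge0. Qed.

Lemma rnorm0 : rnorm (0 : V) = 0. Proof. by rewrite /rnorm normr0. Qed.

Lemma rnorm_eq0 x : rnorm x = 0 -> x = 0.
Proof. by move=> x0; apply/eqP; rewrite -normr_eq0 rnormE x0. Qed.

Lemma rnormN x : rnorm (- x) = rnorm x.
Proof. by rewrite /rnorm normrN. Qed.

Lemma rnormBC x y : rnorm (x - y) = rnorm (y - x).
Proof. by rewrite /rnorm distrC. Qed.

Lemma rnormD x y : rnorm (x + y) <= rnorm x + rnorm y.
Proof. by rewrite -lecR rmorphD /= -!rnormE ler_normD. Qed.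

Lemma rnorm_dist_trans y x z : rnorm (x - z) <= rnorm (x - y) + rnorm (y - z).
Proof. by have := rnormD (x - y) (y - z); rewrite addrA subrK. Qed.

Lemma rnormZr (r : R) x : 0 <= r -> rnorm (r%:C *: x) = r * rnorm x.
Proof. by move=> r0; rewrite rnormZ ger0_norm ?ler0c. Qed.

Lemma rnormD_inner x y :
  rnorm (x + y) ^+ 2 = rnorm x ^+ 2 + 2 * complex.Re (inner x y) + rnorm y ^+ 2.
Proof.
apply: complexI; rewrite -innerxx linearDl !linearDr /= !innerxx [inner y x]innerC.
rewrite !rmorphD /=.
have E : inner x y + (inner x y)^*%R = 2%:C * (complex.Re (inner x y))%:C.
  by case: (inner x y) => a b; apply/eqP; rewrite eq_complex /=; apply/andP; split; apply/eqP; ring.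
rewrite -(_ : inner x y + (inner x y)^*%R = (2 * complex.Re (inner x y))%:C);
  last by rewrite E rmorphM.
ring.
Qed.

Lemma rnormD_orth x y : inner x y = 0 ->
  rnorm (x + y) ^+ 2 = rnorm x ^+ 2 + rnorm y ^+ 2.
Proof. by move=> xy; rewrite rnormD_inner xy /= mulr0 addr0. Qed.

Lemma rnorm_parallelogram x y :
  rnorm (x + y) ^+ 2 + rnorm (x - y) ^+ 2 = 2 * rnorm x ^+ 2 + 2 * rnorm y ^+ 2.
Proof.
rewrite !rnormD_inner rnormN linearNr raddfN /=; ring.
Qed.

Lemma inner_CauchySchwarz x y :
  complex.Re `|inner x y| <= rnorm x * rnorm y.
Proof.
rewrite -(@ler_pXn2r _ 2) ?nnegrE ?mulr_ge0 ?rnorm_ge0//; last first.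
  by rewrite -ler0c (RRe_real (normr_real _)).
rewrite exprMn -lecR realCX realCM (RRe_real (normr_real _)).
by rewrite -2!innerxx; exact: dot_CauchySchwarz.
Qed.

Lemma Re_inner_le x y : complex.Re (inner x y) <= rnorm x * rnorm y.
Proof.
apply: le_trans (inner_CauchySchwarz x y).
rewrite -lecR (RRe_real (normr_real _)).
apply: le_trans (normc_ge_Re _); rewrite lecR; exact: ler_norm.
Qed.

Lemma inner_self_eq0 x : inner x x = 0 -> x = 0.
Proof.
rewrite innerxx => h; apply/rnorm_eq0/eqP; rewrite -sqrf_eq0.
by apply/eqP; exact: complexI.
Qed.

Lemma inner_eq0 x : (forall y, inner x y = 0) -> x = 0.
Proof. by move=> /(_ x)/inner_self_eq0. Qed.

End InnerProduct.

Section NormLimits.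
Context (R : realType).

Lemma cvg_rnormP (V : normedModType R[i]) (T : Type) (F : set_system T)
    (FF : Filter F) (u : T -> V) (l : V) :
  u @ F --> l <-> forall e : R, 0 < e -> \forall t \near F, rnorm (l - u t) < e.
Proof.
split=> [ul e e0|ul].
  have e0C : 0 < e%:C :> R[i] by rewrite ltcR.
  move/cvgrPdist_lt : ul => /(_ _ e0C); apply: filterS => t.
  by rewrite rnormE ltcR.
apply/cvgrPdist_lt => e e0.
have eE : e = (complex.Re e)%:C by rewrite RRe_real// gtr0_real.
have re0 : 0 < complex.Re e by rewrite -ltcR -eE.
by apply: filterS (ul _ re0) => t; rewrite rnormE eE ltcR.
Qed.

Lemma cvgn_rnormP (V : normedModType R[i]) (u : nat -> V) (l : V) :
  u @ \oo --> l <->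
  forall e : R, 0 < e -> exists N, forall n, (N <= n)%N -> rnorm (l - u n) < e.
Proof.
split=> [/cvg_rnormP ul e e0|ul].
  by have [N _ h] := ul _ e0; exists N.
by apply/cvg_rnormP => e e0; have [N h] := ul _ e0; exists N.
Qed.

Lemma rnorm_complete (V : hilbertType R) (u : nat -> V) :
  (forall e : R, 0 < e -> exists N, forall m n, (N <= m)%N -> (N <= n)%N ->
     rnorm (u m - u n) < e) -> cvgn u.
Proof.
move=> uC; apply: cauchy_cvg; apply/cauchyP => e e0.
have eE : e = (complex.Re e)%:C by rewrite RRe_real// gtr0_real.
have re0 : 0 < complex.Re e by rewrite -ltcR -eE.
have [N h] := uC _ re0; exists (u N); exists N => // n /= Nn.
by rewrite -ball_normE /= rnormE eE ltcR; exact: h.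
Qed.

Lemma closure_rnormP (V : normedModType R[i]) (B : set V) (x : V) :
  closure B x <-> forall e : R, 0 < e -> exists2 y, B y & rnorm (x - y) < e.
Proof.
split=> [clx e e0|h].
  have e0C : 0 < e%:C :> R[i] by rewrite ltcR.
  have [y [By]] := clx _ (nbhsx_ballx x _ e0C).
  by rewrite -ball_normE /= rnormE ltcR => xy; exists y.
move=> U /nbhs_ballP[e /= e0 eU].
have eE : e = (complex.Re e)%:C by rewrite RRe_real// gtr0_real.
have re0 : 0 < complex.Re e by rewrite -ltcR -eE.
have [y By xy] := h _ re0; exists y; split => //; apply: eU.
by rewrite -ball_normE /= rnormE eE ltcR.
Qed.

(** Limits of inner products are handled through explicit errors of size [e * c];
    this and [normC_eps_eq0] remove such an error once [e] is arbitrary. *)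
Lemma eps_le0 (r c : R) : (forall e : R, 0 < e -> r <= e * c) -> r <= 0.
Proof.
move=> h; rewrite leNgt; apply/negP => r0.
have c1 : 0 < `|c| + 1 by rewrite ltr_wpDl.
have := h (r / (2 * (`|c| + 1))) (divr_gt0 r0 (mulr_gt0 _ c1)).
have cc := ler_norm c.
rewrite mulrAC ler_pdivlMr ?mulr_gt0//; nra.
Qed.

Lemma normC_eps_eq0 (z : R[i]) (c : R) :
  (forall e : R, 0 < e -> complex.Re `|z| <= e * c) -> z = 0.
Proof.
move=> /eps_le0 z0; apply/eqP; rewrite -normr_eq0 -(RRe_real (normr_real z)).
apply/eqP; congr (_%:C); apply/eqP; rewrite eq_le z0 -ler0c.
by rewrite (RRe_real (normr_real _)) normr_ge0.
Qed.

Lemma linear_bounded_continuous (V W : normedModType R[i]) (T : {linear V -> W}) (c : R) :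
  (forall x, rnorm (T x) <= c * rnorm x) -> continuous T.
Proof.
move=> Tc x; apply/cvg_rnormP => e e0.
have c1 : 0 < `|c| + 1 by rewrite ltr_wpDl.
have d0 : 0 < e / (`|c| + 1) by rewrite divr_gt0.
have := @cvg_id _ (nbhs x) => /cvg_rnormP /(_ _ d0); apply: filterS => y.
rewrite -raddfB ltr_pdivlMr// => h; apply: le_lt_trans h.
apply: (le_trans (Tc _)); rewrite mulrC ler_wpM2l ?Re_norm_ge0//.
by rewrite (le_trans (ler_norm _))// lerDl.
Qed.

Lemma cvgn_eventually_eq (V : normedModType R[i]) (u : nat -> V) (l c : V) (M : nat) :
  u @ \oo --> l -> (forall m, (M <= m)%N -> u m = c) -> l = c.
Proof.
move=> ul uc; apply: (cvg_unique _ ul); first exact: norm_hausdorff.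
by apply: cvg_near_cst; exists M.
Qed.

End NormLimits.

Lemma sum_nat_single (W : nmodType) (P : pred nat) (F : nat -> W) k m :
  (k < m)%N -> P k -> (forall n, P n -> n != k -> F n = 0) ->
  \sum_(0 <= n < m | P n) F n = F k.
Proof.
move=> km Pk F0; rewrite big_mkcond (bigD1_seq k) ?iota_uniq ?mem_index_iota//= Pk.
by rewrite big1 ?addr0// => n nk; case: ifP => // Pn; exact: F0.
Qed.

(** * Orthogonal projection and the representation of functionals *)

Section Projection.
Context (R : realType) (V : hilbertType R).
Implicit Types (M B : set V) (x y : V).

Definition subspace M := M 0 /\ forall (a : R[i]) x y, M x -> M y -> M (a *: x + y).

Lemma subspaceD M x y : subspace M -> M x -> M y -> M (x + y).
Proof. by move=> [_ MP] Mx My; rewrite -(scale1r x); exact: MP. Qed.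

Lemma subspaceZ M a x : subspace M -> M x -> M (a *: x).
Proof. by move=> [M0 MP] Mx; rewrite -(addr0 (a *: x)); exact: MP. Qed.

Lemma subspace_sum M (I : Type) (r : seq I) (P : pred I) (F : I -> V) :
  subspace M -> (forall i, P i -> M (F i)) -> M (\sum_(i <- r | P i) F i).
Proof.
move=> sM MF; elim/big_ind : _ => [|x y Mx My|i /MF//]; first by case: sM.
exact: subspaceD.
Qed.

(** The functional [q x = |x|^2 - 2 Re (phi x)] is bounded below and strictly
    convex: by the parallelogram law two near-minimisers in [M] are close, so a
    minimising sequence converges, and stationarity at the limit [p] says that
    [p] represents [phi] on [M].  Taking [M] to be the whole space gives
    the Riesz representation, taking [phi = inner _ x] gives the orthogonal
    projection; one minimisation serves both. *)
Lemma riesz_subspace M (phi : V -> R[i]) (C : R) : subspace M ->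
  (forall a x y, phi (a *: x + y) = a * phi x + phi y) ->
  (forall x, complex.Re `|phi x| <= C * rnorm x) ->
  exists2 p, closure M p & forall x, M x -> phi x = inner x p.
Proof.
move=> sM phiP phiC.
have phiD x y : phi (x + y) = phi x + phi y.
  by rewrite -[x]scale1r phiP mul1r scale1r.
have phiZ a x : phi (a *: x) = a * phi x.
  have phi0 : phi 0 = 0.
    by apply: (addrI (phi 0)); rewrite -phiD !addr0.
  by rewrite -[a *: x]addr0 phiP phi0 addr0.
have phiRe x : complex.Re (phi x) <= C * rnorm x.
  apply: le_trans (phiC x); rewrite -lecR (RRe_real (normr_real _)).
  by apply: le_trans (normc_ge_Re _); rewrite lecR; exact: ler_norm.
pose q x := rnorm x ^+ 2 - 2 * complex.Re (phi x).
have qC x : - C ^+ 2 <= q x.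
  rewrite /q; have := phiRe x; have := sqr_ge0 (rnorm x - C); nra.
pose I := inf (q @` M).
have lbq : has_lbound (q @` M) by exists (- C ^+ 2) => _ [x _ <-].
have hiq : has_inf (q @` M) by split => //; exists (q 0), 0 => //; case: sM.
have Iq x : M x -> I <= q x by move=> Mx; apply: ge_inf => //; exists x.
have /choice[u uP] : forall n : nat, exists x, M x /\ q x < I + n.+1%:R^-1.
  move=> n; have n0 : 0 < n.+1%:R^-1 :> R by rewrite invr_gt0.
  have [_ [x Mx <-] qx] := inf_adherent n0 hiq.
  by exists x.
have qdist x y : M x -> M y -> rnorm (x - y) ^+ 2 <= 2 * (q x - I) + 2 * (q y - I).
  move=> Mx My; have := Iq _ (subspaceZ (2^-1)%:C sM (subspaceD sM Mx My)).
  rewrite /q rnormZr ?invr_ge0// phiZ phiD.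
  have -> : complex.Re ((2^-1)%:C * (phi x + phi y)) =
     2^-1 * (complex.Re (phi x) + complex.Re (phi y)).
    by case: (phi x) => a b; case: (phi y) => c d /=; rewrite mul0r subr0.
  have := rnorm_parallelogram x y; rewrite exprMn; lra.
have inv_small (e : R) : 0 < e -> exists N, forall n, (N <= n)%N -> n.+1%:R^-1 < e.
  move=> e0; have [N _ h] := near_infty_natSinv_lt (PosNum e0).
  by exists N.
have /cvg_ex[p up] : cvgn u.
  apply: rnorm_complete => e e0.
  have e4 : 0 < e ^+ 2 / 4 by rewrite divr_gt0 ?exprn_gt0.
  have [N h] := inv_small _ e4; exists N => m n Nm Nn.
  rewrite -(@ltr_pXn2r _ 2) ?nnegrE ?rnorm_ge0 ?(ltW e0)//.
  have [Mm qm] := uP m; have [Mn qn] := uP n.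
  apply: le_lt_trans (qdist _ _ Mm Mn) _.
  have {}qm : q (u m) - I < e ^+ 2 / 4.
    by rewrite ltrBlDl (lt_trans qm)// ltrD2l h.
  have {}qn : q (u n) - I < e ^+ 2 / 4.
    by rewrite ltrBlDl (lt_trans qn)// ltrD2l h.
  lra.
exists p.
  apply/closure_rnormP => e e0; have [N h] := (cvgn_rnormP _ _).1 up _ e0.
  by exists (u N); [have [] := uP N|exact: h].
(* First variation: q (u n + x) >= I for the minimising sequence, then n -> oo. *)
pose psi x := inner x p - phi x.
have psile x : M x -> - (2 * complex.Re (psi x)) <= rnorm x ^+ 2.
  move=> Mx; rewrite -subr_le0; apply: (@eps_le0 _ _ (1 + 2 * rnorm x)) => e e0.
  have [N1 h1] := inv_small _ e0; have [N2 h2] := (cvgn_rnormP _ _).1 up _ e0.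
  pose n := maxn N1 N2; have {}h1 := h1 n (leq_maxl _ _).
  have {}h2 := h2 n (leq_maxr _ _).
  have [Mn qn] := uP n; have := Iq _ (subspaceD sM Mn Mx).
  rewrite /q rnormD_inner phiD raddfD /= -/(q _) => hI.
  have d := Re_inner_le x (u n - p); rewrite linearBr raddfB /= rnormBC in d.
  have -> : complex.Re (psi x) = complex.Re (inner x p) - complex.Re (phi x).
    by rewrite /psi raddfB.
  have E : complex.Re (inner (u n) x) = complex.Re (inner x (u n)).
    by rewrite innerC; case: (inner x (u n)).
  rewrite E in hI; rewrite /q in qn.
  have x0 := rnorm_ge0 x.
  have : rnorm x * rnorm (p - u n) <= rnorm x * e by rewrite ler_wpM2l// ltW.
  have {}qn := lt_trans qn (ler_ltD (lexx I) h1).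
  lra.
move=> x Mx; apply/eqP; rewrite eq_sym -subr_eq0 -/(psi x) -normr_eq0.
have [k k0 kE] : exists2 k : R, 0 <= k & `|psi x| = k%:C.
  exists (complex.Re `|psi x|); last by rewrite RRe_real ?normr_real.
  by rewrite -ler0c RRe_real ?normr_real.
suff : 2 * k ^+ 2 <= 0 by rewrite kE; move=> h; apply/eqP; congr (_%:C); nra.
(* Test the variation in the direction - t (psi x)^* x, where psi is - t |psi x|^2. *)
apply: (@eps_le0 _ _ (k ^+ 2 * rnorm x ^+ 2)) => t t0.
have := psile _ (subspaceZ (- (t%:C) * (psi x)^*%R) sM Mx).
have -> : psi ((- (t%:C) * (psi x)^*%R) *: x) = (- (t * k ^+ 2))%:C.
  rewrite /psi phiZ innerZl -mulrBr -/(psi x) -mulrA [_ * psi x]mulrC -normCK kE.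
  by rewrite -realCX mulNr -realCM rmorphN.
rewrite rnormZ normrM norm_conjC normrN kE.
rewrite ger0_norm ?ler0c ?(ltW t0)// -realCM /= => h.
by rewrite -(ler_pM2l t0); nra.
Qed.

Lemma projection M x : subspace M ->
  exists2 p, closure M p & forall y, M y -> inner y (x - p) = 0.
Proof.
move=> sM; have [||p Mp h] := @riesz_subspace M (fun y => inner y x) (rnorm x) sM.
- by move=> a y z; rewrite linearDl /= innerZl.
- by move=> y; rewrite mulrC; exact: inner_CauchySchwarz.
by exists p => // y My; rewrite linearBr /= h// subrr.
Qed.

Lemma closure_orth M x y : (forall z, M z -> inner x z = 0) -> closure M y ->
  inner x y = 0.
Proof.
move=> xM /closure_rnormP My; apply: (@normC_eps_eq0 _ _ (rnorm x)) => e e0.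
have [z Mz yz] := My _ e0.
have -> : inner x y = inner x (y - z) by rewrite linearBr /= (xM z)// subr0.
apply: le_trans (inner_CauchySchwarz _ _) _.
by rewrite mulrC ler_wpM2r ?rnorm_ge0// ltW.
Qed.

Lemma span_subspace B : subspace (linear_span B).
Proof.
split; first by exists 0%N, (fun=> 0), (fun=> 0); rewrite big_ord0; split => // -[].
move=> a x y [n [c [b [Bb ->]]]] [m [d [b' [Bb' ->]]]].
pose w (T : Type) (f : 'I_n -> T) (g : 'I_m -> T) (k : 'I_(n + m)) :=
  match fintype.split k with inl i => f i | inr j => g j end.
exists (n + m)%N, (w _ (fun i => a * c i) d), (w _ b b'); split.
  by rewrite /w => k; case: (fintype.split k).
rewrite big_split_ord /= scaler_sumr; congr (_ + _); apply: eq_bigr => i _.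
  by rewrite /w (unsplitK (inl i)) scalerA.
by rewrite /w (unsplitK (inr i)).
Qed.

Lemma sub_span B x : B x -> linear_span B x.
Proof.
by move=> Bx; exists 1%N, (fun=> 1), (fun=> x); rewrite big_ord1 scale1r.
Qed.

Lemma span_min B M : subspace M -> B `<=` M -> linear_span B `<=` M.
Proof.
move=> sM BM _ [n [c [b [Bb ->]]]]; apply: subspace_sum => // k _.
by apply: subspaceZ => //; exact/BM.
Qed.

Lemma orth_subspace x : subspace [set y | inner x y = 0].
Proof.
split => /= [|a y z xy xz]; first by rewrite linear0r.
by rewrite linearDr /= innerZr xy xz mulr0 addr0.
Qed.

Lemma closure_span_orth B x y : (forall z, B z -> inner x z = 0) ->
  closure (linear_span B) y -> inner x y = 0.
Proof.
by move=> xB; apply: closure_orth; exact: (span_min (orth_subspace x)).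
Qed.

(** Density of a span becomes triviality of the orthogonal complement, which is
    the form in which maximality arguments produce it. *)
Lemma total_spanP B : closure (linear_span B) = [set: V] <->
  forall x, (forall b, B b -> inner x b = 0) -> x = 0.
Proof.
split=> [clB x xB|B0].
  by apply: inner_eq0 => y; apply: (closure_span_orth xB); rewrite clB.
apply/seteqP; split => // x _.
have [p Bp xp] := projection x (span_subspace B).
suff -> : x = p by [].
apply/eqP; rewrite -subr_eq0; apply/eqP; apply: B0 => b Bb.
by apply: inner_eq0C; apply: xp; exact: sub_span.
Qed.

End Projection.

(** * Adjoints of contractions *)

Section Adjoints.
Context (R : realType) (V : hilbertType R).
Implicit Types (T : {linear V -> V}) (x y : V).

Definition nonexpansive (T : V -> V) := forall x, rnorm (T x) <= rnorm x.

(** Adjoints and square roots are first found as plain functions; this repackages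
    them as bundled linear maps. *)
Lemma linear_fun_ex (f : V -> V) : linear f ->
  exists T : {linear V -> V}, T =1 f.
Proof.
move=> fL.
pose m := GRing.isLinear.Build R[i] V V *:%R f fL.
pose T : {linear V -> V} := HB.pack f m.
by exists T.
Qed.

Lemma contraction_nonexpansive T : contraction T -> nonexpansive T.
Proof.
rewrite /contraction /op_norm => T1 x.
have [x0|xn0] := eqVneq (rnorm x) 0; first by rewrite (rnorm_eq0 x0) linear0 rnorm0.
have r0 : 0 < rnorm x by rewrite lt_neqAle eq_sym xn0 rnorm_ge0.
pose y := ((rnorm x)^-1)%:C *: x.
have y1 : rnorm y <= 1 by rewrite rnormZr ?invr_ge0 ?rnorm_ge0// mulVf.
have : ((rnorm (T y))%:E <= 1)%E.
  by apply: le_trans T1; apply: ereal_sup_ubound; exists y.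
rewrite lee_fin linearZ /= rnormZr ?invr_ge0 ?rnorm_ge0//.
by rewrite ler_pdivrMl// mulr1.
Qed.

Lemma is_adjoint_sym T T' : is_adjoint T T' -> is_adjoint T' T.
Proof. by move=> TT' x y; rewrite innerC -TT' -innerC. Qed.

Lemma is_adjoint_unique T T1 T2 : is_adjoint T T1 -> is_adjoint T T2 -> T1 =1 T2.
Proof.
move=> h1 h2 y; apply/eqP; rewrite -subr_eq0; apply/eqP/inner_eq0 => x.
by apply: inner_eq0C; rewrite linearBr /= -h1 -h2 subrr.
Qed.

(** [adjoint] is a choice among all adjoints, so this is an existence statement:
    [x |-> inner (T x) y] is bounded and hence represented by a vector. *)
Lemma adjointP T : nonexpansive T -> is_adjoint T (adjoint T).
Proof.
move=> T1.
suff [T' T'P] : exists T', is_adjoint T T' by exact: (xgetI (\0 : {linear V -> V}) T'P).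
have /choice[f fP] : forall y, exists p, forall x, inner (T x) y = inner x p.
  move=> y; have sT : subspace [set: V] by split.
  have [||p _ h] := @riesz_subspace R V _ (fun x => inner (T x) y) (rnorm y) sT.
  - by move=> a u v; rewrite linearP linearDl /= innerZl.
  - move=> x; apply: le_trans (inner_CauchySchwarz _ _) _.
    by rewrite mulrC ler_wpM2l ?rnorm_ge0.
  by exists p => x; exact: h.
have fL : linear f.
  move=> a y z; apply/eqP; rewrite -subr_eq0; apply/eqP/inner_eq0 => x.
  apply: inner_eq0C; rewrite linearBr linearDr /= innerZr -!fP.
  by rewrite linearDr /= innerZr subrr.
have [T' T'E] := linear_fun_ex fL.
by exists T' => x y; rewrite T'E.
Qed.

Lemma adjoint_nonexpansive T : nonexpansive T -> nonexpansive (adjoint T).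
Proof.
move=> T1 y; set z := adjoint T y.
have h : rnorm z ^+ 2 <= rnorm z * rnorm y.
  have : complex.Re (inner (T z) y) <= rnorm z * rnorm y.
    by apply: le_trans (Re_inner_le _ _) _; rewrite ler_wpM2r ?rnorm_ge0.
  by rewrite (adjointP T1) -/z innerxx.
have := rnorm_ge0 z; rewrite le_eqVlt => /orP[/eqP <-|z0]; first exact: rnorm_ge0.
by rewrite -(ler_pM2l z0) -expr2.
Qed.

Lemma adjointK T : nonexpansive T -> adjoint (adjoint T) =1 T.
Proof.
move=> T1; have h := adjointP (adjoint_nonexpansive T1).
exact: (is_adjoint_unique h (is_adjoint_sym (adjointP T1))).
Qed.

Lemma nonexpansive_continuous T : nonexpansive T -> continuous T.
Proof.
by move=> T1; apply: (@linear_bounded_continuous _ _ _ _ 1) => x; rewrite mul1r.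
Qed.

Lemma nonexpansive_cvg T (u : nat -> V) (l : V) : nonexpansive T ->
  u @ \oo --> l -> (T \o u) @ \oo --> T l.
Proof.
by move=> T1 ul; apply: continuous_cvg => //; exact: nonexpansive_continuous.
Qed.

End Adjoints.

(** * The square root of 1 - X *)

Section SquareRoot.
Context (R : realType) (V : hilbertType R).
Implicit Types (T X : {linear V -> V}) (x y : V).

(** Writing the square root of [1 - X] as [1 - Y] turns the equation into the
    fixed point problem [Y = (X + Y^2) / 2]; these are its iterates from [0]. *)
Fixpoint sqrt_iter X (n : nat) : {linear V -> V} :=
  if n is m.+1 then (2^-1)%:C \*: (X \+ (sqrt_iter X m \o sqrt_iter X m)) else \0.

(** The same iteration for the scalar [X = 1].  The iterates of [X] are polynomials
    in [X] with nonnegative coefficients, and so are their successive differences,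
    so these numbers bound both the iterates and their increments. *)
Fixpoint sqrt_bound (n : nat) : R :=
  if n is m.+1 then 2^-1 * (1 + sqrt_bound m ^+ 2) else 0.

Lemma sqrt_iterS X n x :
  sqrt_iter X n.+1 x = (2^-1)%:C *: (X x + sqrt_iter X n (sqrt_iter X n x)).
Proof. by []. Qed.

Lemma sqrt_bound_ge0 n : 0 <= sqrt_bound n.
Proof. by case: n => //= n; rewrite mulr_ge0 ?addr_ge0 ?sqr_ge0. Qed.

Lemma sqrt_bound_le1 n : sqrt_bound n <= 1.
Proof.
by elim: n => //= n IH; have := sqrt_bound_ge0 n; nra.
Qed.

Lemma sqrt_bound_nd : nondecreasing_seq sqrt_bound.
Proof.
apply/nondecreasing_seqP => n /=; have := sqr_ge0 (1 - sqrt_bound n); nra.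
Qed.

(** Applied to [X = X'] this gives the commutation of the iterates; applied to
    [A^* A] and [A A^*] it will give the intertwining of the defect operators. *)
Lemma sqrt_iter_intertwine T X X' : (forall x, T (X x) = X' (T x)) ->
  forall n x, T (sqrt_iter X n x) = sqrt_iter X' n (T x).
Proof.
move=> TX; elim=> [|n IH] x; first by rewrite /= linear0.
by rewrite !sqrt_iterS linearZ linearD /= TX !IH.
Qed.

Lemma sqrt_iter_comm X m n x :
  sqrt_iter X m (sqrt_iter X n x) = sqrt_iter X n (sqrt_iter X m x).
Proof.
apply: sqrt_iter_intertwine => y; apply: esym.
exact: sqrt_iter_intertwine.
Qed.

Section Nonexpansive.
Variable X : {linear V -> V}.
Hypothesis X1 : nonexpansive X.

Let hC0 : 0 <= 2^-1 :> R. Proof. by rewrite invr_ge0. Qed.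

Lemma sqrt_iter_bound n x : rnorm (sqrt_iter X n x) <= sqrt_bound n * rnorm x.
Proof.
elim: n x => [|n IH] x; first by rewrite /= rnorm0 mul0r.
rewrite sqrt_iterS rnormZr// -mulrA ler_wpM2l//.
apply: le_trans (rnormD _ _) _; rewrite mulrDl mul1r lerD// expr2 -mulrA.
by apply: le_trans (IH _) _; rewrite ler_wpM2l ?sqrt_bound_ge0.
Qed.

Lemma sqrt_iter_nonexpansive n : nonexpansive (sqrt_iter X n).
Proof.
move=> x; apply: le_trans (sqrt_iter_bound n x) _.
by rewrite ler_piMl ?rnorm_ge0 ?sqrt_bound_le1.
Qed.

(** Since the iterates commute, consecutive increments satisfy
    [Y'' - Y' = (Y' + Y) (Y' - Y) / 2], and the scalar bounds satisfy the same
    recursion. *)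
Lemma sqrt_iter_step n x : rnorm (sqrt_iter X n.+1 x - sqrt_iter X n x) <=
  (sqrt_bound n.+1 - sqrt_bound n) * rnorm x.
Proof.
elim: n x => [|n IH] x.
  have -> : sqrt_iter X 0 x = 0 by [].
  by rewrite [sqrt_bound 0]/= !subr0; exact: sqrt_iter_bound.
set Y := sqrt_iter X n.+1; set Z := sqrt_iter X n.
have -> : sqrt_iter X n.+2 x - Y x = (2^-1)%:C *: (Y (Y x - Z x) + Z (Y x - Z x)).
  have ZY : Z (Y x) = Y (Z x) by exact: sqrt_iter_comm.
  have -> : sqrt_iter X n.+2 x = (2^-1)%:C *: (X x + Y (Y x)) by [].
  rewrite [X in _ - X = _](_ : Y x = (2^-1)%:C *: (X x + Z (Z x)))//.
  rewrite -scalerBr; congr (_ *: _).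
  have -> : Y (Y x - Z x) = Y (Y x) - Y (Z x) by exact: raddfB.
  have -> : Z (Y x - Z x) = Y (Z x) - Z (Z x) by rewrite -ZY; exact: raddfB.
  rewrite [RHS]addrA subrK.
  by rewrite opprD addrACA subrr add0r.
rewrite rnormZr//.
have -> : sqrt_bound n.+2 - sqrt_bound n.+1 =
  2^-1 * ((sqrt_bound n.+1 + sqrt_bound n) * (sqrt_bound n.+1 - sqrt_bound n)).
  have -> : sqrt_bound n.+2 = 2^-1 * (1 + sqrt_bound n.+1 ^+ 2) by [].
  rewrite [X in _ - X = _](_ : _ = 2^-1 * (1 + sqrt_bound n ^+ 2))//; ring.
rewrite -mulrA ler_wpM2l//; apply: le_trans (rnormD _ _) _.
rewrite -mulrA mulrDl; apply: lerD.
  by apply: le_trans (sqrt_iter_bound _ _) _; rewrite ler_wpM2l ?sqrt_bound_ge0.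
by apply: le_trans (sqrt_iter_bound _ _) _; rewrite ler_wpM2l ?sqrt_bound_ge0.
Qed.

Lemma sqrt_iter_dist m n x : (n <= m)%N ->
  rnorm (sqrt_iter X m x - sqrt_iter X n x) <= (sqrt_bound m - sqrt_bound n) * rnorm x.
Proof.
move=> /subnK <-; elim: (m - n)%N => [|k IH]; first by rewrite add0n !subrr rnorm0 mul0r.
rewrite addSn; apply: le_trans (rnorm_dist_trans (sqrt_iter X (k + n) x) _ _) _.
apply: le_trans (lerD (sqrt_iter_step _ _) IH) _.
by rewrite -mulrDl addrA subrK.
Qed.

Definition sqrt_lim x := limn (fun n => sqrt_iter X n x).

(** The increments are dominated by those of a bounded monotone real sequence. *)
Lemma sqrt_iter_cvg x : (fun n => sqrt_iter X n x) @ \oo --> sqrt_lim x.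
Proof.
apply: rnorm_complete => e e0.
have c : cvgn sqrt_bound.
  apply: nondecreasing_is_cvgn sqrt_bound_nd _.
  by exists 1 => _ [n _ <-]; exact: sqrt_bound_le1.
have x1 : 0 < rnorm x + 1 by rewrite ltr_wpDl ?rnorm_ge0.
have d0 : 0 < e / (rnorm x + 1) by rewrite divr_gt0.
have /cvgrPdist_lt/(_ _ d0)[N _ h] := c.
exists N.
have H m n : (N <= n <= m)%N -> rnorm (sqrt_iter X m x - sqrt_iter X n x) < e.
  move=> /andP[Nn nm]; apply: le_lt_trans (sqrt_iter_dist _ nm) _.
  have : sqrt_bound m - sqrt_bound n < e / (rnorm x + 1).
    apply: le_lt_trans (h _ Nn); apply: le_trans (ler_norm _); rewrite lerD2r.
    exact: nondecreasing_cvgn_le sqrt_bound_nd c m.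
  rewrite ltr_pdivlMr//; apply: le_lt_trans.
  by rewrite ler_wpM2l ?subr_ge0 ?sqrt_bound_nd ?lerDl.
move=> m n Nm Nn; have [nm|/ltnW mn] := leqP n m; first by rewrite H ?Nn.
by rewrite rnormBC H ?Nm.
Qed.

Lemma sqrt_lim_eq x l : (fun n => sqrt_iter X n x) @ \oo --> l -> sqrt_lim x = l.
Proof. by move=> h; apply: cvg_lim => //; exact: norm_hausdorff. Qed.

Lemma sqrt_lim_linear : linear sqrt_lim.
Proof.
move=> a x y; apply: sqrt_lim_eq.
have -> : (fun n => sqrt_iter X n (a *: x + y)) =
          (fun n => a *: sqrt_iter X n x + sqrt_iter X n y).
  by apply/funext => n; rewrite linearP.
by apply: cvgD; [apply: cvgZl_tmp; exact: sqrt_iter_cvg | exact: sqrt_iter_cvg].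
Qed.

Lemma sqrt_lim_nonexpansive : nonexpansive sqrt_lim.
Proof.
move=> x; rewrite -subr_le0; apply: (@eps_le0 _ _ 1) => e e0.
have [N h] := (cvgn_rnormP _ _).1 (@sqrt_iter_cvg x) _ e0.
have := rnormD (sqrt_lim x - sqrt_iter X N x) (sqrt_iter X N x).
rewrite subrK; have := sqrt_iter_nonexpansive N x; have := h N (leqnn N); lra.
Qed.

Lemma sqrt_lim_fix x : X x + sqrt_lim (sqrt_lim x) = 2%:C *: sqrt_lim x.
Proof.
have c2 : (fun n => sqrt_iter X n (sqrt_iter X n x)) @ \oo --> sqrt_lim (sqrt_lim x).
  apply/cvgn_rnormP => e e0; have e20 : 0 < e / 2 by rewrite divr_gt0.
  have [N1 h1] := (cvgn_rnormP _ _).1 (@sqrt_iter_cvg x) _ e20.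
  have [N2 h2] := (cvgn_rnormP _ _).1 (@sqrt_iter_cvg (sqrt_lim x)) _ e20.
  exists (maxn N1 N2) => n; rewrite geq_max => /andP[n1 n2].
  apply: le_lt_trans (rnorm_dist_trans (sqrt_iter X n (sqrt_lim x)) _ _) _.
  rewrite [ltRHS]splitr ltrD ?h2// -linearB.
  by apply: le_lt_trans (sqrt_iter_nonexpansive _ _) _; exact: h1.
have c1 : (fun n => sqrt_iter X n.+1 x) @ \oo --> sqrt_lim x.
  have := @sqrt_iter_cvg x; rewrite -(cvg_shiftS (fun n => sqrt_iter X n x)); exact.
have c3 : (fun n => sqrt_iter X n.+1 x) @ \oo -->
          (2^-1)%:C *: (X x + sqrt_lim (sqrt_lim x)).
  by apply: cvgZl_tmp; apply: cvgD; [exact: cvg_cst | exact: c2].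
rewrite [in RHS](_ : sqrt_lim x = (2^-1)%:C *: (X x + sqrt_lim (sqrt_lim x))); last first.
  by apply: (cvg_unique _ c1 c3); exact: norm_hausdorff.
by rewrite scalerA -realCM mulfV ?pnatr_eq0// scale1r.
Qed.

End Nonexpansive.
End SquareRoot.

(** * Positive operators and defect operators *)

Section PositiveOperators.
Context (R : realType) (V : hilbertType R).
Implicit Types (A T D E X : {linear V -> V}) (x y z : V).

(** An identity between inner products passes to the limit on both sides; the
    threshold [N] allows identities that only hold eventually. *)
Lemma inner_lim_eq (u w : nat -> V) (l m x y : V) (N : nat) :
  u @ \oo --> l -> w @ \oo --> m ->
  (forall n, (N <= n)%N -> inner (u n) y = inner x (w n)) -> inner l y = inner x m.
Proof.
move=> ul wm uw; apply/eqP; rewrite -subr_eq0; apply/eqP.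
apply: (@normC_eps_eq0 _ _ (rnorm x + rnorm y)) => e e0.
have [N1 h1] := (cvgn_rnormP _ _).1 ul _ e0.
have [N2 h2] := (cvgn_rnormP _ _).1 wm _ e0.
pose n := maxn N (maxn N1 N2).
have {}h1 : rnorm (l - u n) < e by apply: h1; rewrite !leq_max leqnn orbT.
have {}h2 : rnorm (m - w n) < e by apply: h2; rewrite !leq_max leqnn !orbT.
have -> : inner l y - inner x m = inner (l - u n) y - inner x (m - w n).
  by rewrite linearBl linearBr /= uw ?leq_maxl// opprB addrA subrK.
have a1 := inner_CauchySchwarz (l - u n) y.
have a2 := inner_CauchySchwarz x (m - w n).
have a3 : complex.Re `|inner (l - u n) y - inner x (m - w n)| <=
    complex.Re `|inner (l - u n) y| + complex.Re `|inner x (m - w n)|.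
  rewrite -lecR rmorphD !(RRe_real (normr_real _)); exact: ler_normB.
have := rnorm_ge0 x; have := rnorm_ge0 y; nra.
Qed.

(** Over the complex numbers, a sesquilinear form vanishing on the diagonal is
    zero; here the form is [inner (D x) y - inner x (D y)]. *)
Lemma positive_selfadjoint D : positive_op D -> is_adjoint D D.
Proof.
move=> D0; pose B x y := inner (D x) y - inner x (D y).
have Bxx x : B x x = 0.
  rewrite /B [inner x (D x)]innerC.
  by have /CrealP -> := ger0_real (D0 x); rewrite subrr.
move=> x y; apply/eqP; rewrite -subr_eq0 -/(B x y); apply/eqP.
have BD a b : B (a + b) (a + b) = B a b + B b a.
  have := Bxx a; have := Bxx b.
  rewrite /B (linearD D) !linearDl /= !linearDr /= => hb ha.
  rewrite -[RHS]add0r -[RHS]add0r -{1}ha -hb; ring.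
have e1 : B x y + B y x = 0 by rewrite -BD Bxx.
have e2 : - 'i%R * B x y + 'i%R * B y x = 0.
  have DZ : D ('i%R *: y) = 'i%R *: D y by rewrite linearZ.
  rewrite -[RHS](Bxx (x + 'i%R *: y)) BD /B DZ !innerZl !innerZr conjCi; ring.
have i0 : 'i%R != 0 :> R[i] by exact: neq0Ci.
have e3 : B y x = B x y.
  apply: (mulfI i0); apply/eqP; rewrite -subr_eq0; apply/eqP; rewrite -[RHS]e2; ring.
by apply/eqP; move/eqP: e1; rewrite e3 -mulr2n mulrn_eq0.
Qed.

(** Positivity at the single vector [x - D x] is enough: it reads
    [0 <= - 2 |D x|^2 + <D^2 x, D x> <= - |D x|^2]. *)
Lemma positive_inner_eq0 D x : positive_op D -> nonexpansive D ->
  inner (D x) x = 0 -> D x = 0.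
Proof.
move=> D0 D1 Dx; have DD := positive_selfadjoint D0.
have := D0 (x - D x); rewrite (linearB D) linearBl !linearBr /= Dx.
rewrite [inner (D (D x)) x]DD innerxx => h.
have : 0 <= complex.Re (0 - (rnorm (D x) ^+ 2)%:C -
    ((rnorm (D x) ^+ 2)%:C - inner (D (D x)) (D x))).
  by move: h; rewrite lecE => /andP[].
rewrite !raddfB /= => {}h.
have h2 := Re_inner_le (D (D x)) (D x).
have h3 := ler_wpM2r (rnorm_ge0 (D x)) (D1 (D x)).
apply: rnorm_eq0; apply/eqP; rewrite -sqrf_eq0 eq_le sqr_ge0 andbT; nra.
Qed.

End PositiveOperators.

Section SquareRootTheory.
Context (R : realType) (V : hilbertType R).
Implicit Types (A T D E X : {linear V -> V}) (x y z : V).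

Lemma sqrt_lim_intertwine T X X' : nonexpansive X -> nonexpansive X' -> nonexpansive T ->
  (forall x, T (X x) = X' (T x)) -> forall x, T (sqrt_lim X x) = sqrt_lim X' (T x).
Proof.
move=> X1 X'1 T1 TX x; apply: esym; apply: sqrt_lim_eq.
have -> : (fun n => sqrt_iter X' n (T x)) = T \o (fun n => sqrt_iter X n x).
  by apply/funext => n /=; rewrite (sqrt_iter_intertwine TX).
by apply: nonexpansive_cvg => //; exact: sqrt_iter_cvg.
Qed.

Lemma sqrt_lim_selfadjoint X : nonexpansive X -> is_adjoint X X ->
  forall x y, inner (sqrt_lim X x) y = inner x (sqrt_lim X y).
Proof.
move=> X1 XX x y; apply: (inner_lim_eq (N := 0) (@sqrt_iter_cvg _ _ _ X1 x)
  (@sqrt_iter_cvg _ _ _ X1 y)).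
move=> n _; elim: n x y => [|n IH] x y; first by rewrite /= linear0l linear0r.
rewrite !sqrt_iterS innerZl innerZr conj_realC linearDl linearDr /= XX.
by rewrite !IH.
Qed.

Lemma sqrt_op_ex X : nonexpansive X -> is_adjoint X X ->
  exists D, is_sqrt_op (idfun \- X) D /\ forall x, D x = x - sqrt_lim X x.
Proof.
move=> X1 XX; have [D DE] : exists D, D =1 (fun x => x - sqrt_lim X x).
  apply: linear_fun_ex => a x y; rewrite sqrt_lim_linear// scalerBr.
  by rewrite opprD addrACA.
have Y1 := sqrt_lim_nonexpansive X1.
have YY := sqrt_lim_selfadjoint X1 XX.
exists D; split => //; split.
- apply: (@linear_bounded_continuous _ _ _ _ 2) => x.
  rewrite DE; apply: le_trans (rnormD _ _) _.
  by rewrite rnormN mulrDl mul1r lerD2l.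
- move=> x; rewrite DE linearBl /= innerxx.
  have -> : inner (sqrt_lim X x) x = (complex.Re (inner (sqrt_lim X x) x))%:C.
    by rewrite RRe_real//; apply/CrealP; rewrite -innerC YY.
  rewrite -rmorphB ler0c subr_ge0; apply: le_trans (Re_inner_le _ _) _.
  by rewrite expr2 ler_wpM2r ?rnorm_ge0.
- move=> x; rewrite !DE /=.
  have LB : sqrt_lim X (x - sqrt_lim X x) = sqrt_lim X x - sqrt_lim X (sqrt_lim X x).
    have := sqrt_lim_linear X1 (-1) (sqrt_lim X x) x.
    by rewrite !scaleN1r ![- _ + _]addrC.
  have := sqrt_lim_fix X1 x => /(canRL (addrK _)) ->.
  rewrite LB (_ : 2%:C = 1 + 1); last by rewrite rmorphD.
  by rewrite scalerDl scale1r -addrA -opprD addrA.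
Qed.

(** A square root [D] of [1 - X] commutes with [X], hence with the constructed
    root [S].  For [y = D x - S x] this gives [(D + S) y = 0], so the nonnegative
    numbers [<D y, y>] and [<S y, y>] add up to zero; both [D y] and [S y] vanish,
    and then so does [<y, y>]. *)
Lemma sqrt_op_unique X D : nonexpansive X -> is_adjoint X X ->
  positive_op D -> nonexpansive D -> (forall x, D (D x) = x - X x) ->
  forall x, D x = x - sqrt_lim X x.
Proof.
move=> X1 XX D0 D1 DD x.
have [S [[_ S0 SS] SE]] := sqrt_op_ex X1 XX.
have DX y : D (X y) = X (D y).
  have XE z : X z = z - D (D z) by rewrite DD opprB addrC subrK.
  by rewrite !XE linearB.
have DS y : D (S y) = S (D y).
  by rewrite !SE linearB /= (sqrt_lim_intertwine X1 X1 D1 DX).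
rewrite -SE; apply/eqP; rewrite -subr_eq0.
set y := D x - S x.
have SDy : S y = - D y.
  apply/eqP; rewrite -addr_eq0 /y !linearB /= -DS SS DD /=.
  by rewrite addrC addrA subrK subrr.
have e1 : inner (D y) y = 0.
  apply/eqP; rewrite eq_le D0 andbT.
  by have := S0 y; rewrite SDy linearNl oppr_ge0.
have e2 := positive_inner_eq0 D0 D1 e1.
have e3 : S y = 0 by rewrite SDy e2 oppr0.
apply/eqP/inner_self_eq0; rewrite {1}/y linearBl /=.
by rewrite (positive_selfadjoint D0) (positive_selfadjoint S0) e2 e3 !linear0r subrr.
Qed.

Section Defect.
Variable A : {linear V -> V}.
Hypothesis A1 : nonexpansive A.

Let A'1 : nonexpansive (adjoint A). Proof. exact: adjoint_nonexpansive. Qed.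

Let X : {linear V -> V} := adjoint A \o A.

Let X1 : nonexpansive X.
Proof. by move=> x; exact: le_trans (A'1 _) (A1 _). Qed.

Let XX : is_adjoint X X.
Proof.
by move=> x y; rewrite /= -(adjointP A1) (is_adjoint_sym (adjointP A1)).
Qed.

Lemma defect_is_sqrt : is_sqrt_op (idfun \- (adjoint A \o A)) (defect_op A).
Proof.
have [D [DP _]] := sqrt_op_ex X1 XX.
exact: (xgetI (\0 : {linear V -> V}) DP).
Qed.

Lemma defect_sq x : defect_op A (defect_op A x) = x - adjoint A (A x).
Proof. by have [_ _ ->] := defect_is_sqrt. Qed.

Lemma defect_positive : positive_op (defect_op A).
Proof. by have [] := defect_is_sqrt. Qed.

Lemma defect_nonexpansive : nonexpansive (defect_op A).
Proof.
move=> x; rewrite -(@ler_pXn2r _ 2) ?nnegrE ?rnorm_ge0// -lecR -innerxx.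
rewrite (positive_selfadjoint defect_positive) defect_sq linearBr /= innerxx.
by rewrite -(adjointP A1) innerxx -rmorphB lecR lerBlDr lerDl sqr_ge0.
Qed.

(** [defect_op] is chosen among the square roots; uniqueness ties the choice to the
    limit of polynomials in [A^* A], to which intertwining relations extend. *)
Lemma defect_limE x : defect_op A x = x - sqrt_lim (adjoint A \o A) x.
Proof.
apply: (sqrt_op_unique X1 XX defect_positive defect_nonexpansive) => y.
exact: defect_sq.
Qed.

End Defect.

Lemma defect_adjoint_sq A x : nonexpansive A ->
  defect_op (adjoint A) (defect_op (adjoint A) x) = x - A (adjoint A x).
Proof.
by move=> A1; rewrite defect_sq ?adjointK//; exact: adjoint_nonexpansive.
Qed.

(** The commutation of [A^*] past [A A^*], which turns it into [A^* A], passes to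
    polynomials and to their limits. *)
Lemma defect_intertwine A x : nonexpansive A ->
  adjoint A (defect_op (adjoint A) x) = defect_op A (adjoint A x).
Proof.
move=> A1; have A'1 := adjoint_nonexpansive A1.
have A''1 := adjoint_nonexpansive A'1.
rewrite !defect_limE// linearB /=; congr (_ - _).
apply: sqrt_lim_intertwine => //.
- by move=> y; exact: le_trans (A''1 _) (A'1 _).
- by move=> y; exact: le_trans (A'1 _) (A1 _).
- by move=> y /=; rewrite adjointK.
Qed.

(** For [h = D x - mu x] one has [D h = - mu h], which positivity forbids unless
    [h = 0]; when [mu = 0] instead, [|D x|^2 = <D^2 x, x> = 0]. *)
Lemma positive_sqrt_eigen D (mu : R) x : positive_op D -> 0 <= mu ->
  D (D x) = (mu ^+ 2)%:C *: x -> D x = mu%:C *: x.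
Proof.
move=> D0 mu0 Dx; set h := D x - mu%:C *: x.
have Dh : D h = - (mu%:C *: h).
  rewrite /h linearB linearZ /= Dx scalerBr scalerA -realCM -expr2.
  by rewrite opprB.
suff h0 : h = 0 by apply/eqP; rewrite -subr_eq0 -/h h0.
move: mu0; rewrite le_eqVlt => /orP[/eqP mu0|mu0].
  rewrite /h -mu0 scale0r subr0; apply: inner_self_eq0.
  by rewrite (positive_selfadjoint D0) Dx -mu0 expr0n /= scale0r linear0r.
have := D0 h; rewrite Dh linearNl /= innerZl innerxx -realCM oppr_ge0.
rewrite -[0]/(0%:C) lecR => hh; apply: rnorm_eq0; apply/eqP; rewrite -sqrf_eq0.
by rewrite eq_le sqr_ge0 andbT -(pmulr_rle0 _ mu0).
Qed.

End SquareRootTheory.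

(** * Maximal orthonormal sets *)

Section MaximalOrthonormal.
Context (R : realType) (V : hilbertType R).
Implicit Types (B E : set V) (x u v : V).

Definition orthonormal_set B := forall u v, B u -> B v -> inner u v = (u == v)%:R.

(** Zorn's lemma, applied to the sets [C] such that [B0] together with [C] is
    orthonormal: asking for [B0 `<=` C] instead would fail for the empty chain. *)
Lemma orthonormal_set_ex E B0 :
  (forall (a : R[i]) x, a != 0 -> E x -> E (a *: x)) ->
  orthonormal_set B0 -> B0 `<=` E ->
  exists B, [/\ B0 `<=` B, B `<=` E, orthonormal_set B &
    forall x, E x -> (forall b, B b -> inner x b = 0) -> x = 0].
Proof.
move=> EZ oB0 B0E.
pose P C := orthonormal_set (B0 `|` C) /\ C `<=` E.
have [F FP Ftot|C [[oC CE] Cmax]] := @Zorn_bigcup V P.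
  split; last by move=> x [C FC Cx]; have [_ CE] := FP _ FC; exact: CE.
  have key C u v : F C -> (B0 `|` C) u -> (B0 `|` C) v -> inner u v = (u == v)%:R.
    by move=> /FP[oC _]; exact: oC.
  move=> u v [Bu|[C FC Cu]] [Bv|[D FD Dv]].
  - exact: oB0.
  - by apply: (key D) => //; [left|right].
  - by apply: (key C) => //; [right|left].
  - have [CD|DC] := Ftot _ _ FC FD.
      by apply: (key D) => //; right => //; exact: CD.
    by apply: (key C) => //; right => //; exact: DC.
exists (B0 `|` C); split => //.
  by move=> x [/B0E|/CE].
move=> x Ex xB; apply: contrapT => /eqP xn0.
have r0 : rnorm x != 0 by apply: contra xn0 => /eqP/rnorm_eq0 ->.
pose y := ((rnorm x)^-1)%:C *: x.
have yy : inner y y = 1.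
  rewrite innerxx rnormZr ?invr_ge0 ?rnorm_ge0// mulVf// expr1n.
  by [].
have yB b : (B0 `|` C) b -> inner y b = 0.
  by move=> Bb; rewrite innerZl xB ?mulr0.
have yNB : ~ (B0 `|` C) y.
  by move=> /yB; rewrite yy => /eqP; rewrite oner_eq0.
have ne b : (B0 `|` C) b -> (y == b) = false.
  by move=> Bb; apply/eqP => yb; apply: yNB; rewrite yb.
apply: (Cmax (C `|` [set y])); split.
- by move=> z Cz; left.
- by move=> /(_ y) h; apply: yNB; right; apply: h; right.
- rewrite setUA => u v [Bu|/= ->] [Bv|/= ->].
  + exact: oC.
  + by rewrite (inner_eq0C (yB _ Bu)) eq_sym ne.
  + by rewrite yB// ne.
  + by rewrite yy eqxx.
- move=> z [/CE//|/= ->]; apply: EZ => //.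
  by rewrite -[0]/(0%:C) (inj_eq (@complexI _)) invr_eq0.
Qed.

Lemma eigenvectorZ (T : {linear V -> V}) (a : R[i]) x :
  a != 0 -> eigenvector T x -> eigenvector T (a *: x).
Proof.
move=> a0 [x0 [l Tx]]; split; first by rewrite scaler_eq0 negb_or a0.
by exists l; rewrite linearZ /= Tx !scalerA mulrC.
Qed.

Lemma orthonormal_neq u v : inner u u = 1 -> inner u v = 0 -> (u == v) = false.
Proof.
by move=> uu uv; apply/eqP => h; move: uv; rewrite -h uu => /eqP; rewrite oner_eq0.
Qed.

Lemma orthonormal_system_rnorm (N : option nat) (e : nat -> V) k :
  orthonormal_system N e -> index_range N k -> rnorm (e k) = 1.
Proof.
move=> oe Nk; have := oe _ _ Nk Nk; rewrite eqxx innerxx => /complexI h.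
by apply/eqP; rewrite -(@eqrXn2 _ 2) ?rnorm_ge0// h expr1n.
Qed.

End MaximalOrthonormal.

(** * Coordinates in the direct sum *)

Section DirectSumInner.
Context (R : realType) (V : hilbertType R).
Implicit Types (x y : hsumZ V) (u v : V).

Lemma zpsum_single (g : int -> R[i]) (j : int) (n : nat) :
  (forall i, i != j -> g i = 0) -> (`|j|%N < n)%N -> zpsum g n = g j.
Proof.
move=> g0; case: j g0 => k g0 kn; rewrite /zpsum (bigD1_seq k) ?iota_uniq ?mem_index_iota//=.
- rewrite [g (Negz k)]g0// addr0 big1_seq ?addr0// => i /andP[ik _].
  by rewrite !g0 ?addr0.
- rewrite [g (Posz k)]g0// add0r big1_seq ?addr0// => i /andP[ik _].
  by rewrite !g0 ?addr0.
- exact: ltnW.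
Qed.

Lemma inner_single x j v : inner x (hsum_single j v) = inner (x j) v.
Proof.
apply: hsum_inner_unique; apply: cvg_near_cst.
exists `|j|.+1 => // n /= jn; rewrite (@zpsum_single _ j)//= ?eqxx//.
by move=> i /negPf ->; rewrite linear0r.
Qed.

Definition hpair u v : hsumZ V := hsum_single 0 u + hsum_single 1 v.

Lemma hpair0 u v : hpair u v 0 = u.
Proof. by rewrite hsumDE /= addr0. Qed.

Lemma hpair1 u v : hpair u v 1 = v.
Proof. by rewrite hsumDE /= add0r. Qed.

Lemma hpair_out u v i : i != 0 -> i != 1 -> hpair u v i = 0.
Proof. by move=> i0 i1; rewrite hsumDE /= (negPf i0) (negPf i1) addr0. Qed.

Lemma inner_hpair x u v : inner x (hpair u v) = inner (x 0) u + inner (x 1) v.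
Proof. by rewrite linearDr /= !inner_single. Qed.

(** The shift realigns the superdiagonal of the dilation, so that the product is
    the identity away from the two coordinates 0 and 1, where it is the unitary
    block with rows [D, - A^*] and [A, E], where [D] and [E] are the defect operators
    of [A] and [A^*]. *)
Lemma shift_dilationE (A : {linear V -> V}) x i :
  (@bishift R V \o dilation A) x i =
  if i == 1 then A (x 0) + defect_op (adjoint A) (x 1)
  else if i == 0 then defect_op A (x 0) - adjoint A (x 1)
  else x i.
Proof.
rewrite [LHS](dilation_funE A x (i - 1)).
rewrite subr_eq0 (_ : (i - 1 == -1) = (i == 0)) ?subrK//.
by rewrite -subr_eq0 opprK subrK.
Qed.

End DirectSumInner.

(** * From a Schmidt decomposition to an eigenbasis *)

Section SchmidtFacts.
Context (R : realType) (V : hilbertType R).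
Variables (A : {linear V -> V}) (N : option nat) (f g : nat -> V) (s : nat -> R).
Hypothesis A1 : nonexpansive A.
Hypotheses (of_ : orthonormal_system N f) (og : orthonormal_system N g).
Hypothesis s0 : forall n, index_range N n -> 0 < s n.
Hypothesis Acvg : forall h, (fun m => \sum_(0 <= n < m | index_range N n)
   (s n)%:C *: rank_one (f n) (g n) h) @ \oo --> A h.

Lemma schmidt_apply k : index_range N k -> A (g k) = (s k)%:C *: f k.
Proof.
move=> Nk; apply: (cvgn_eventually_eq (M := k.+1) (@Acvg (g k))) => m km.
rewrite (sum_nat_single km Nk); first by rewrite /rank_one og// eqxx scale1r.
by move=> n Nn nk; rewrite /rank_one og// eq_sym (negPf nk) scale0r scaler0.
Qed.

Lemma schmidt_adjoint k : index_range N k -> adjoint A (f k) = (s k)%:C *: g k.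
Proof.
move=> Nk; apply/eqP; rewrite -subr_eq0; apply/eqP/inner_eq0 => h.
apply: inner_eq0C; rewrite linearBr /= -(adjointP A1); apply/eqP; rewrite subr_eq0.
apply/eqP; apply: (inner_lim_eq (N := k.+1) (@Acvg h) (cvg_cst _)) => m km.
rewrite linear_sumlz /= (sum_nat_single km Nk).
  by rewrite /rank_one !innerZl of_// eqxx mulr1 innerZr conj_realC.
by move=> n Nn nk; rewrite /rank_one !innerZl of_// (negPf nk) !mulr0.
Qed.

Lemma schmidt_ker h : (forall k, index_range N k -> inner h (g k) = 0) -> A h = 0.
Proof.
move=> hg; apply: (cvgn_eventually_eq (M := 0) (@Acvg h)) => m _.
by rewrite big1// => n Nn; rewrite /rank_one hg// scale0r scaler0.
Qed.

Lemma schmidt_adjoint_ker y :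
  (forall k, index_range N k -> inner y (f k) = 0) -> adjoint A y = 0.
Proof.
move=> yf; apply: inner_eq0 => h; apply: inner_eq0C; rewrite -(adjointP A1).
rewrite -[RHS](linear0r inner h).
apply: (inner_lim_eq (N := 0) (@Acvg h) (cvg_cst _)) => m _.
rewrite linear0r linear_sumlz /= big1// => n Nn.
by rewrite /rank_one !innerZl [inner (f n) y](inner_eq0C (yf _ Nn)) !mulr0.
Qed.

Lemma schmidt_le1 k : index_range N k -> s k <= 1.
Proof.
move=> Nk; have := A1 (g k); rewrite schmidt_apply// rnormZr; last exact/ltW/s0.
by rewrite (orthonormal_system_rnorm of_ Nk) (orthonormal_system_rnorm og Nk) mulr1.
Qed.

Let c k := Num.sqrt (1 - s k ^+ 2).

Let c_sq k : index_range N k -> c k ^+ 2 = 1 - s k ^+ 2.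
Proof.
move=> Nk; rewrite sqr_sqrtr// subr_ge0.
by rewrite expr_le1 ?schmidt_le1// ltW// s0.
Qed.

Lemma schmidt_defect k : index_range N k -> defect_op A (g k) = (c k)%:C *: g k.
Proof.
move=> Nk; apply: positive_sqrt_eigen (defect_positive A1) (sqrtr_ge0 _) _.
rewrite defect_sq// schmidt_apply// linearZ /= schmidt_adjoint// scalerA -realCM.
by rewrite c_sq// rmorphB scalerBl scale1r expr2.
Qed.

Lemma schmidt_defect_adjoint k : index_range N k ->
  defect_op (adjoint A) (f k) = (c k)%:C *: f k.
Proof.
move=> Nk.
apply: positive_sqrt_eigen (defect_positive (adjoint_nonexpansive A1)) (sqrtr_ge0 _) _.
rewrite defect_adjoint_sq// schmidt_adjoint// linearZ /= schmidt_apply// scalerA -realCM.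
by rewrite c_sq// rmorphB scalerBl scale1r expr2.
Qed.

Let r : R[i] := (Num.sqrt 2^-1)%:C.

Let r_sq : r * r = 2^-1.
Proof.
rewrite -realCM -expr2 sqr_sqrtr ?invr_ge0//.
by rewrite fmorphV rmorphD.
Qed.

Let sg (b : bool) : R[i] := (-1) ^+ b * 'i%R.

Let sg_conj b b' : sg b * (sg b')^*%R = (-1) ^+ (b (+) b').
Proof.
have ii : 'i%R * 'i%R = -1 :> R[i] by rewrite -expr2 sqrCi.
rewrite /sg rmorphM rmorph_sign /= conjCi signr_addb mulrACA mulrN ii opprK mulr1.
by [].
Qed.

(** On the plane spanned by [g k] in coordinate 0 and [f k] in coordinate 1 the
    unitary block is the rotation with cosine [sqrt (1 - s_k^2)] and sine [s_k],
    whose eigenvectors are [(g k, i f k)] and [(g k, - i f k)]. *)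
Definition dilation_eigenvec (b : bool) k : hsumZ V :=
  r *: hpair (g k) (sg b *: f k).

Lemma inner_eigenvec b k b' k' : index_range N k -> index_range N k' ->
  inner (dilation_eigenvec b k) (dilation_eigenvec b' k') = ((b == b') && (k == k'))%:R.
Proof.
move=> Nk Nk'; rewrite /dilation_eigenvec innerZl innerZr conj_realC inner_hpair.
rewrite hpair0 hpair1 innerZl innerZr of_// og//.
rewrite mulrA r_sq mulrA sg_conj -{1}[(k == k')%:R]mul1r -mulrDl.
have h2 : 2^-1 * (1 + 1) = 1 :> R[i] by rewrite mulVf// pnatr_eq0.
case: b b' (k == k') => [] [] [] /=; rewrite ?expr0 ?expr1 ?mulr0// ?mulr1.
- by rewrite h2.
- by rewrite subrr mulr0.
- by rewrite subrr mulr0.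
- by rewrite h2.
Qed.

Lemma eigenvec_eigenvector b k : index_range N k ->
  eigenvector (@bishift R V \o dilation A) (dilation_eigenvec b k).
Proof.
move=> Nk; split.
  apply/eqP => h; have := inner_eigenvec b b Nk Nk.
  by rewrite h linear0l !eqxx => /esym/eqP; rewrite oner_eq0.
exists ((c k)%:C - sg b * (s k)%:C).
have WZ p : (@bishift R V \o dilation A) (r *: p) = r *: (@bishift R V \o dilation A) p.
  by rewrite /comp !linearZ.
rewrite /dilation_eigenvec WZ [RHS]scalerA [_ * r]mulrC -[RHS]scalerA; congr (_ *: _).
have ss : sg b * sg b = -1.
  have ii : 'i%R * 'i%R = -1 :> R[i] by rewrite -expr2 sqrCi.
  by rewrite /sg mulrACA -signr_addb addbb mul1r ii.
apply: hsum_eqP => i; rewrite hsumZE shift_dilationE hpair0 hpair1.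
have -> : defect_op (adjoint A) (sg b *: f k) = sg b *: defect_op (adjoint A) (f k).
  by rewrite linearZ.
have -> : adjoint A (sg b *: f k) = sg b *: adjoint A (f k) by rewrite linearZ.
rewrite schmidt_apply// schmidt_adjoint// schmidt_defect//.
rewrite schmidt_defect_adjoint// !scalerA.
have [->|i1] := eqVneq i 1.
  rewrite hpair1 -scalerDl scalerA; congr (_ *: _).
    transitivity (sg b * (c k)%:C - sg b * sg b * (s k)%:C); last by ring.
  by rewrite ss mulN1r opprK addrC mulrC.
have [->|i0] := eqVneq i 0; first by rewrite hpair0 -scalerBl.
by rewrite hpair_out// scaler0.
Qed.

(** A maximal orthonormal set of eigenvectors containing the vectors above is
    total: a vector orthogonal to them has its coordinates 0 and 1 in the kernels
    of [A] and [A^*], where both defect operators act as the identity, so it is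
    fixed by the operator and would otherwise extend the set. *)
Lemma schmidt_diagonalizable :
  diagonalizable_op (@bishift R V \o dilation A).
Proof.
pose W : {linear hsumZ V -> hsumZ V} := @bishift R V \o dilation A.
pose B0 := [set v | exists b k, index_range N k /\ v = dilation_eigenvec b k].
have [||B [B0B BE oB Bmax]] := @orthonormal_set_ex _ _ (eigenvector W) B0
  (fun a x => @eigenvectorZ _ _ W a x).
- move=> _ _ [b [k [Nk ->]]] [b' [k' [Nk' ->]]].
  rewrite inner_eigenvec//; have [/andP[/eqP -> /eqP ->]|h] := boolP (_ && _).
    by rewrite eqxx.
  rewrite orthonormal_neq// inner_eigenvec ?eqxx//.
  by rewrite (negPf h).
- by move=> _ [b [k [Nk ->]]]; exact: eigenvec_eigenvector.
exists B; split => //; split => //; apply/total_spanP => x xB.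
have [//|/eqP xn0] := pselect (x = 0); apply: Bmax => //; split => //.
exists 1; rewrite scale1r.
have x01 k : index_range N k -> inner (x 0) (g k) = 0 /\ inner (x 1) (f k) = 0.
  move=> Nk.
  have r0 : r != 0.
    by apply/eqP => r0; have := r_sq; rewrite r0 mulr0 => /esym/eqP; rewrite invr_eq0 pnatr_eq0.
  have h b : inner (x 0) (g k) + (sg b)^*%R * inner (x 1) (f k) = 0.
    have : inner x (dilation_eigenvec b k) = 0 by apply: xB; apply: B0B; exists b, k.
    rewrite innerZr inner_hpair innerZr conj_realC => /eqP.
    by rewrite mulf_eq0 (negPf r0) => /eqP.
  have ht := h true; have hf := h false.
  have sgc b : (sg b)^*%R = - ((-1) ^+ b * 'i%R).
    by rewrite /sg rmorphM rmorph_sign /= conjCi mulrN.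
  rewrite sgc /= expr1 in ht; rewrite sgc /= expr0 in hf.
  have i0 : 'i%R != 0 :> R[i] by exact: neq0Ci.
  have e1 : inner (x 0) (g k) = 0.
    apply: (mulfI (_ : 2%:R != 0)); first by rewrite pnatr_eq0.
    rewrite mulr0 -[RHS](addr0 0) -{1}ht -hf; ring.
  split => //; apply: (mulfI i0); by rewrite mulr0 -[RHS]ht e1 add0r mulN1r opprK.
have A0 : A (x 0) = 0 by apply: schmidt_ker => j Nj; case: (x01 _ Nj).
have A'1 : adjoint A (x 1) = 0 by apply: schmidt_adjoint_ker => j Nj; case: (x01 _ Nj).
have D0 : defect_op A (x 0) = x 0.
  rewrite -[RHS]scale1r; apply: (@positive_sqrt_eigen _ _ _ 1) => //.
    exact: defect_positive.
  by rewrite defect_sq// A0 linear0 subr0 expr1n scale1r.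
have E1 : defect_op (adjoint A) (x 1) = x 1.
  rewrite -[RHS]scale1r; apply: (@positive_sqrt_eigen _ _ _ 1) => //.
    exact/defect_positive/adjoint_nonexpansive.
  by rewrite defect_adjoint_sq// A'1 linear0 subr0 expr1n scale1r.
apply: hsum_eqP => i; rewrite shift_dilationE A0 A'1 D0 E1 add0r subr0.
by have [->//|_] := eqVneq i 1; have [->|] := eqVneq i 0.
Qed.

End SchmidtFacts.

(** * From an eigenbasis to a Schmidt decomposition *)

Section SpectralReduction.
Context (R : realType) (V : hilbertType R).
Implicit Types (A X : {linear V -> V}) (x u v : V).

(** For an eigenvalue [l], apply [D_A] to the equation of coordinate 0 and [A^*] to
    that of coordinate 1, and add.  The cross terms cancel by the intertwining
    relation, leaving [v 0 = l (D_A (v 0) + A^* (v 1))]; eliminating [A^* (v 1)]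
    gives [(1 + l^2) v 0 = 2 l D_A (v 0)].  So [v 0] is an eigenvector of [D_A],
    hence of [A^* A = 1 - D_A^2], unless it vanishes. *)
Lemma shift_dilation_eigen A (v : hsumZ V) : nonexpansive A ->
  eigenvector (@bishift R V \o dilation A) v ->
  exists t : R[i], adjoint A (A (v 0)) = t *: v 0.
Proof.
move=> A1 [_ [l Wv]].
have e0 : defect_op A (v 0) - adjoint A (v 1) = l *: v 0.
  by rewrite -hsumZE -Wv shift_dilationE.
have e1 : A (v 0) + defect_op (adjoint A) (v 1) = l *: v 1.
  by rewrite -hsumZE -Wv shift_dilationE.
have d0 : v 0 - adjoint A (A (v 0)) - defect_op A (adjoint A (v 1)) = l *: defect_op A (v 0).
  by rewrite -linearZ -e0 linearB /= defect_sq.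
have d1 : adjoint A (A (v 0)) + defect_op A (adjoint A (v 1)) = l *: adjoint A (v 1).
  by rewrite -linearZ -e1 linearD /= defect_intertwine.
have v0E : v 0 = l *: defect_op A (v 0) + l *: adjoint A (v 1).
  by rewrite -d0 -d1 -[v 0 - _ - _]addrA -opprD subrK.
have A'v1 : adjoint A (v 1) = defect_op A (v 0) - l *: v 0.
  by rewrite -e0 opprB addrC subrK.
have {}v0E : (1 + l * l) *: v 0 = (2 * l) *: defect_op A (v 0).
  rewrite scalerDl scale1r {1}v0E A'v1 scalerBr scalerA addrA subrK -scalerDl.
  by rewrite mulr_natl mulr2n.
have [l0|l0] := eqVneq l 0.
  exists 0; move: v0E; rewrite l0 !mulr0 addr0 scale1r scale0r => ->.
  by rewrite !linear0.
have ll : 2 * l != 0 by rewrite mulf_neq0// pnatr_eq0.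
pose mu := (1 + l * l) / (2 * l).
have Dv : defect_op A (v 0) = mu *: v 0.
  by rewrite /mu mulrC -scalerA v0E scalerA mulVf// scale1r.
exists (1 - mu * mu); have := defect_sq A1 (v 0).
rewrite Dv linearZ /= Dv scalerA => h.
by rewrite scalerBl scale1r h opprB addrC subrK.
Qed.

(** Let [G] be a maximal orthonormal set of eigenvectors.  For an eigenvector [v],
    the component [w] of [v] orthogonal to [G] is zero or an eigenvector for the
    same eigenvalue, as both the closed span of [G] and its complement are
    invariant; maximality leaves [w = 0], so every eigenvector lies in the closed
    span of [G]. *)
Lemma selfadjoint_eigenbasis X : is_adjoint X X ->
  (forall x, (forall v, eigenvector X v -> inner x v = 0) -> x = 0) ->
  exists G, orthonormal_basis G /\ forall v, G v -> eigenvector X v.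
Proof.
move=> XX tot.
have [|//|G [_ GE oG Gmax]] := @orthonormal_set_ex _ _ (eigenvector X) set0
  (fun a x => @eigenvectorZ _ _ X a x); first by [].
exists G; split => //; split => //; apply/total_spanP => x xG; apply: tot => v Ev.
have Xperp y : (forall g, G g -> inner y g = 0) -> forall g, G g -> inner (X y) g = 0.
  move=> yG g Gg; have [_ [t Xg]] := GE _ Gg.
  by rewrite XX Xg innerZr yG// mulr0.
apply: (closure_span_orth xG).
have [p pG vp] := projection v (span_subspace G).
have [_ [t Xv]] := Ev.
set w := v - p in vp.
have wG g : G g -> inner w g = 0.
  by move=> Gg; apply: inner_eq0C; apply: vp; exact: sub_span.
pose z := X w - t *: w.
have zG g : G g -> inner z g = 0.
  by move=> Gg; rewrite linearBl /= innerZl Xperp// wG// mulr0 subrr.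
have zE : z = t *: p - X p.
  rewrite /z /w linearB /= Xv scalerBr opprB.
  by rewrite addrC addrA subrK.
(* z is orthogonal to G and, by zE, lies in the closed span of G. *)
have z0 : z = 0.
  apply: inner_self_eq0; rewrite {2}zE linearBr /= innerZr -XX.
  by rewrite (closure_span_orth zG pG) (closure_span_orth (Xperp _ zG) pG) mulr0 subrr.
suff w0 : w = 0 by move: (w0) => /eqP; rewrite subr_eq0 => /eqP ->.
have [//|/eqP wn0] := pselect (w = 0).
apply: Gmax => //; split => //; exists t.
by apply/eqP; rewrite -subr_eq0 -/z z0.
Qed.

(** The coordinates at 0 of an eigenbasis of the direct sum are total in the space,
    and each is zero or an eigenvector of [A^* A]. *)
Lemma diagonalizable_eigenbasis A : nonexpansive A ->
  diagonalizable_op (@bishift R V \o dilation A) ->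
  exists G, orthonormal_basis G /\
    forall v, G v -> eigenvector (adjoint A \o A) v.
Proof.
move=> A1 [B [[_ /total_spanP Btot] BE]].
apply: (@selfadjoint_eigenbasis (adjoint A \o A)).
  by move=> x y /=; rewrite -(adjointP A1) (is_adjoint_sym (adjointP A1)).
move=> x xE; suff : hsum_single 0 x = 0 :> hsumZ V.
  by move=> /(congr1 (fun y : hsumZ V => y 0)) /=.
apply: Btot => b Bb; apply: inner_eq0C; rewrite inner_single.
have [t Ab] := shift_dilation_eigen A1 (BE _ Bb).
have [->|b0] := eqVneq (b 0) 0; first by rewrite linear0l.
by apply: inner_eq0C; apply: xE; split => //; exists t.
Qed.

End SpectralReduction.

Section Enumeration.

Lemma countable_enum (T : pointedType) (G : set T) : countable G ->
  exists (N : option nat) (g : nat -> T), set_bij [set n | index_range N n] G g.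
Proof.
move=> cG; have [/finite_setP[m /card_esym/card_set_bijP[g gP]]|iG] := pselect (finite_set G).
  by exists (Some m), g.
have /card_esym/card_set_bijP[g gP] := eq_card_nat cG iG.
exists None, g; rewrite (_ : [set n | _] = setT)//.
by apply/seteqP; split.
Qed.

(** Distinct members are at distance [sqrt 2], so choosing a point of the countable
    dense set within distance [1 / 2] of each is injective. *)
Lemma orthonormal_set_countable (R : realType) (V : hilbertType R) (G : set V) :
  separable_space V -> orthonormal_set G -> countable G.
Proof.
move=> [D [/countable_injP[f finj] dD]] oG.
have /choice[d dP] : forall u : V, exists v, D v /\ rnorm (u - v) < 2^-1.
  move=> u; have e0 : 0 < (2^-1)%:C :> R[i] by rewrite ltcR invr_gt0.
  have [||v [uv Dv]] := dD (ball u (2^-1)%:C).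
  - by exists u; exact: ballxx.
  - exact: ball_open.
  by exists v; split=> //; move: uv; rewrite -ball_normE /= rnormE ltcR.
apply/countable_injP; exists (f \o d) => u v /set_mem Gu /set_mem Gv /= fuv.
have duv : d u = d v by apply: finj => //; apply/mem_set; case: (dP u); case: (dP v).
apply/eqP; case: (boolP (u == v)) => // nuv.
have uv0 : inner u (- v) = 0 by rewrite linearNr /= oG// (negPf nuv) oppr0.
have n1 w : G w -> rnorm w ^+ 2 = 1.
  by move=> Gw; apply: complexI; rewrite -innerxx oG// eqxx.
have := rnormD_orth uv0; rewrite rnormN (n1 _ Gu) (n1 _ Gv) => n2.
have [_ du] := dP u; have [_ dv] := dP v.
have := rnorm_dist_trans (d u) u v; rewrite [rnorm (d u - v)]rnormBC {2}duv => h.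
have := rnorm_ge0 (u - v); nra.
Qed.

End Enumeration.

Section Expansion.
Context (R : realType) (V : hilbertType R).
Variables (N : option nat) (g : nat -> V).
Hypothesis og : orthonormal_system N g.
Implicit Types (h x y : V).

Definition partial_expansion m h : V :=
  \sum_(0 <= n < m | index_range N n) inner h (g n) *: g n.

Lemma inner_partial_expansion m h k : (k < m)%N -> index_range N k ->
  inner (partial_expansion m h) (g k) = inner h (g k).
Proof.
move=> km Nk; rewrite linear_sumlz /= (sum_nat_single km Nk).
  by rewrite innerZl og// eqxx mulr1.
by move=> n Nn nk; rewrite innerZl og// (negPf nk) mulr0.
Qed.

Lemma partial_expansion_bessel m h : rnorm (partial_expansion m h) <= rnorm h.
Proof.
set S := partial_expansion m h.
have hS : inner (h - S) S = 0.
  rewrite {2}/S /partial_expansion linear_sumr /= big1_seq// => n /andP[Nn].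
  rewrite mem_index_iota => /= nm.
  by rewrite innerZr linearBl /= inner_partial_expansion// subrr mulr0.
have := rnormD_orth hS; rewrite subrK => hh.
rewrite -(@ler_pXn2r _ 2) ?nnegrE ?rnorm_ge0// hh lerDr; exact: sqr_ge0.
Qed.

Lemma partial_expansionP m (a : R[i]) x y :
  partial_expansion m (a *: x + y) = a *: partial_expansion m x + partial_expansion m y.
Proof.
rewrite /partial_expansion scaler_sumr -big_split /=; apply: eq_bigr => n _.
by rewrite linearDl /= innerZl scalerDl scalerA.
Qed.

Lemma partial_expansion_basis m k : (k < m)%N -> index_range N k ->
  partial_expansion m (g k) = g k.
Proof.
move=> km Nk; rewrite /partial_expansion (sum_nat_single km Nk).
  by rewrite og// eqxx scale1r.
by move=> n Nn nk; rewrite og// eq_sym (negPf nk) scale0r.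
Qed.

Lemma partial_expansion_orth m h : (forall k, index_range N k -> inner h (g k) = 0) ->
  partial_expansion m h = 0.
Proof.
by move=> hg; rewrite /partial_expansion big1// => n Nn; rewrite hg// scale0r.
Qed.

(** The vectors at which the convergence holds form a subspace containing [G]; it is
    closed because the partial expansions do not increase the norm. *)
Lemma expansion_cvg (A : {linear V -> V}) (G : set V) : nonexpansive A ->
  closure (linear_span G) = [set: V] ->
  (forall v, G v -> (exists2 k, index_range N k & v = g k) \/
     (A v = 0 /\ forall k, index_range N k -> inner v (g k) = 0)) ->
  forall h, (fun m => A (partial_expansion m h)) @ \oo --> A h.
Proof.
move=> A1 clG GN h.
pose C := [set x | (fun m => A (partial_expansion m x)) @ \oo --> A x].
have sC : subspace C.
  split.
    rewrite /C /=; apply: cvg_near_cst; apply: nearW => m.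
    by rewrite partial_expansion_orth// => k _; rewrite linear0l.
  move=> a x y Cx Cy; rewrite /C /= linearP.
  have -> : (fun m => A (partial_expansion m (a *: x + y))) =
    (fun m => a *: A (partial_expansion m x) + A (partial_expansion m y)).
    by apply/funext => m; rewrite partial_expansionP linearP.
  by apply: cvgD => //; exact: cvgZl_tmp.
have GC : G `<=` C.
  move=> v /GN[[k Nk ->]|[Av vg]].
    apply: cvg_near_cst; exists k.+1 => // m /= km.
    by rewrite partial_expansion_basis.
  rewrite /C /= Av; apply: cvg_near_cst; apply: nearW => m.
  by rewrite partial_expansion_orth// linear0.
have spC := span_min sC GC.
apply/cvgn_rnormP => e e0.
have e3 : 0 < e / 3 by rewrite divr_gt0.
have : closure (linear_span G) h by rewrite clG.
move=> /closure_rnormP /(_ _ e3)[y /spC Cy hy].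
have [M hM] := (cvgn_rnormP _ _).1 Cy _ e3.
exists M => m Mm; have := hM _ Mm.
have h1 : rnorm (A h - A y) <= rnorm (h - y) by rewrite -linearB A1.
have h2 : rnorm (A (partial_expansion m y) - A (partial_expansion m h)) <= rnorm (h - y).
  rewrite -linearB; apply: le_trans (A1 _) _.
  have -> : partial_expansion m y - partial_expansion m h = - partial_expansion m (h - y).
    have := partial_expansionP m (-1) y h.
    by rewrite !scaleN1r ![- _ + _]addrC => ->; rewrite opprB.
  by rewrite rnormN; exact: partial_expansion_bessel.
have t1 := rnorm_dist_trans (A y) (A h) (A (partial_expansion m h)).
have t2 := rnorm_dist_trans (A (partial_expansion m y)) (A y) (A (partial_expansion m h)).
lra.
Qed.

End Expansion.

Section Converse.
Context (R : realType) (V : hilbertType R).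

(** Enumerate as [g n] the basis vectors that [A] does not annihilate, and put
    [s n = |A (g n)|], [f n = A (g n) / s n].  Orthogonality of the [f n] is that
    of the [g n], because [<A g_i, A g_j> = <g_i, A^* A g_j>]. *)
Lemma eigenbasis_schmidt (A : {linear V -> V}) (G : set V) : separable_space V ->
  nonexpansive A -> orthonormal_basis G ->
  (forall v, G v -> eigenvector (adjoint A \o A) v) -> schmidt_decomposable A.
Proof.
move=> sepV A1 [oG clG] GE.
pose G1 := [set v | G v /\ A v != 0].
have cG1 : countable G1.
  by apply: orthonormal_set_countable => // u v [Gu _] [Gv _]; exact: oG.
have [N [g [gG1 ginj gsurj]]] : exists (N : option nat) (g : nat -> V),
  set_bij [set n | index_range N n] G1 g := countable_enum cG1.
have Gg n : index_range N n -> G (g n) by move=> /gG1[].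
have Ag n : index_range N n -> A (g n) != 0 by move=> /gG1[].
have og : orthonormal_system N g.
  move=> i j Ni Nj; rewrite (oG _ _ (Gg _ Ni) (Gg _ Nj)).
  have [->|ij] := eqVneq i j; first by rewrite eqxx.
  case: eqP => // gij; case/eqP: ij.
  by apply: ginj => //; apply/mem_set.
pose s n := rnorm (A (g n)).
have s0 n : index_range N n -> 0 < s n.
  move=> Nn; rewrite lt_neqAle rnorm_ge0 andbT eq_sym.
  by apply: contra (Ag _ Nn) => /eqP/rnorm_eq0 ->.
pose f n := ((s n)^-1)%:C *: A (g n).
exists N, f, g, s; split => //.
- move=> i j Ni Nj; rewrite /f innerZl innerZr conj_realC.
  have [<-|ij] := eqVneq i j.
    rewrite innerxx -/(s i) -!realCM; congr (_%:C); rewrite expr2 mulKf ?mulVf//;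
    by rewrite gt_eqF// s0.
  have [_ [t /= Xg]] := GE _ (Gg _ Nj).
  by rewrite (adjointP A1) Xg innerZr og// (negPf ij) !mulr0.
- move=> h; have Gdich v : G v -> (exists2 k, index_range N k & v = g k) \/
     (A v = 0 /\ forall k, index_range N k -> inner v (g k) = 0).
    move=> Gv; have [Av0|Av0] := eqVneq (A v) 0; [right; split => // k Nk|left].
      rewrite (oG _ _ Gv (Gg _ Nk)); case: eqP => // vg.
      by have := Ag _ Nk; rewrite -vg Av0 eqxx.
    by have [k Nk <-] := gsurj v (conj Gv Av0); exists k.
  rewrite (_ : (fun m => _) = (fun m => A (partial_expansion N g m h))).
    exact: (expansion_cvg og A1 clG Gdich).
  apply/funext => m; rewrite linear_sum; apply: eq_bigr => n Nn.
  have -> : A (inner h (g n) *: g n) = inner h (g n) *: A (g n) by rewrite linearZ.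
  rewrite /rank_one /f !scalerA; congr (_ *: _).
  by rewrite mulrAC -realCM mulfV ?mul1r// gt_eqF// s0.
Qed.

End Converse.

(** * Schmidt decomposability and diagonalizability *)

Theorem theorem7p3 (R : realType) (L0 : hilbertType R)
    (L0_separable : separable_space L0)
    (A : {linear L0 -> L0}) (A_contraction : contraction A) :
  schmidt_decomposable A <->
  diagonalizable_op ((@bishift R L0) \o (dilation A)).
Proof.
have A1 := contraction_nonexpansive A_contraction.
split=> [[N [f [g [s [of_ og s0 Acvg]]]]]|Wdiag].
  exact: (schmidt_diagonalizable A1 of_ og s0 Acvg).
have [G [Gbasis GE]] := diagonalizable_eigenbasis A1 Wdiag.
exact: (eigenbasis_schmidt L0_separable A1 Gbasis GE).
Qed.
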